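(* If $G$ is any unicyclic graph except $T_{2,2}$, then $q(G^c)\le 4$, and hence $G$ satisfies: $q(G)+q(G^c)\le |G|+2$ holds if and only if $G$ is not one of the four graphs $P_4$, $P_5$, $P_5^c$ and $T_{2,2}$.
   Context: All graphs are finite, undirected and simple; isomorphic graphs are identified; $|G|$ is the number of vertices of $G$, and $G^c$ is the complement of $G$. A graph is unicyclic if it contains exactly one cycle. For a graph $G$ with vertex set $\{1,\dots,n\}$, $S(G)$ is the set of all real symmetric $n\times n$ matrices $A=(a_{ij})$ such that for $i\ne j$, $a_{ij}\neq 0$ if and only if $\{i,j\}$ is an edge of $G$ (no restriction on the diagonal). $q(A)$ is the number of distinct eigenvalues of $A$, and $q(G)=\min\{q(A): A\in S(G)\}$. $P_n$ is the path on $n$ vertices. $T_{2,2}$ is the graph on $5$ vertices obtained from the path with vertices $1,2,3,4,5$ in order by adding the edge $\{2,4\}$. *)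

(* Defs.v *)
From HB Require Import structures.
From mathcomp Require Import all_boot all_order all_algebra finmap.
From mathcomp Require Import boolp classical_sets cardinality reals.

Set Implicit Arguments.
Unset Strict Implicit.
Unset Printing Implicit Defensive.

Import Order.TTheory GRing.Theory Num.Theory.

Record sgraph (n : nat) := SGraph {
  adj :> rel 'I_n;
  adj_sym : symmetric adj;
  adj_irr : irreflexive adj }.

Definition graph_iso (m n : nat) (G : sgraph m) (H : sgraph n) : Prop :=
  exists2 f : 'I_m -> 'I_n, bijective f & forall i j, H (f i) (f j) = G i j.

Definition compl_rel (n : nat) (G : sgraph n) : rel 'I_n :=
  fun i j => (i != j) && ~~ G i j.

Lemma compl_rel_sym (n : nat) (G : sgraph n) : symmetric (compl_rel G).
Proof. by move=> i j; rewrite /compl_rel eq_sym adj_sym. Qed.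

Lemma compl_rel_irr (n : nat) (G : sgraph n) : irreflexive (compl_rel G).
Proof. by move=> i; rewrite /compl_rel eqxx. Qed.

Definition compl_graph (n : nat) (G : sgraph n) : sgraph n :=
  SGraph (compl_rel_sym G) (compl_rel_irr G).

Definition path_rel (n : nat) : rel 'I_n :=
  fun i j => (i.+1 == j :> nat) || (j.+1 == i :> nat).

Lemma path_rel_sym (n : nat) : symmetric (@path_rel n).
Proof. by move=> i j; rewrite /path_rel orbC. Qed.

Lemma path_rel_irr (n : nat) : irreflexive (@path_rel n).
Proof. by move=> i; rewrite /path_rel orbb gtn_eqF. Qed.

Definition path_graph (n : nat) : sgraph n :=
  SGraph (@path_rel_sym n) (@path_rel_irr n).

(* The vertices 1, ..., 5 are numbered 0, ..., 4 here, so that the edge added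
   to the path joins 1 and 3. *)
Definition T22_rel : rel 'I_5 := fun i j =>
  [|| path_rel i j, (i == 1 :> nat) && (j == 3 :> nat)
    | (i == 3 :> nat) && (j == 1 :> nat)].

Lemma T22_rel_sym : symmetric T22_rel.
Proof.
move=> i j; rewrite /T22_rel path_rel_sym; congr (_ || _).
by rewrite orbC andbC [X in _ || X]andbC.
Qed.

Lemma T22_rel_irr : irreflexive T22_rel.
Proof. by move=> i; rewrite /T22_rel path_rel_irr; case: i => [[|[|[|[|[]]]]]]. Qed.

Definition T22 : sgraph 5 := SGraph T22_rel_sym T22_rel_irr.

(* A cycle is a subgraph, hence is identified with its set of edges: distinct
   closed walks around the same cycle (rotations, reversals) count once. *)
Definition is_cycle (n : nat) (G : sgraph n) (C : {set {set 'I_n}}) : Prop :=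
  exists c : seq 'I_n,
    [/\ 2 < size c, ucycle G c & C = [set [set x; next c x] | x in c]].

Definition unicyclic (n : nat) (G : sgraph n) : Prop :=
  exists! C : {set {set 'I_n}}, is_cycle G C.

Section Eigenvalues.
Variable R : realType.
Local Open Scope ring_scope.
Local Open Scope classical_set_scope.

Lemma finite_eigenvalues (n : nat) (A : 'M[R]_n) :
  finite_set [set a : R | eigenvalue A a].
Proof.
have pN0 : char_poly A != 0 by rewrite monic_neq0 // char_poly_monic.
apply: contrapT => /infinite_set_fset -/(_ (size (char_poly A)))[B BA].
apply/negP; rewrite -ltnNge; apply: max_poly_roots => //.
  by apply/allP => a aB; rewrite -eigenvalue_root_char; apply: BA.
exact: fset_uniq.
Qed.

(* All eigenvalues of a symmetric real matrix are real, so counting those in R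
   loses nothing on the matrices considered below; fset_set is meaningful by
   finite_eigenvalues. *)
Definition q_mx (n : nat) (A : 'M[R]_n) : nat :=
  #|` fset_set [set a : R | eigenvalue A a]|.

Definition S_graph (n : nat) (G : sgraph n) : set 'M[R]_n :=
  [set A | A^T = A /\ forall i j, i != j -> (A i j != 0) = G i j].

Lemma ex_q_graph (n : nat) (G : sgraph n) :
  exists k, `[< exists2 A : 'M[R]_n, S_graph G A & q_mx A = k >].
Proof.
pose A : 'M[R]_n := \matrix_(i, j) (G i j)%:R.
exists (q_mx A); apply/asboolP; exists A => //; split.
  by apply/matrixP => i j; rewrite !mxE adj_sym.
by move=> i j _; rewrite mxE pnatr_eq0 eqb0 negbK.
Qed.

Definition q_graph (n : nat) (G : sgraph n) : nat := ex_minn (ex_q_graph G).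

End Eigenvalues.

(* Main.v *)
Require Import Defs.
From mathcomp Require Import all_boot all_order all_algebra reals.
From mathcomp Require Import finmap boolp cardinality trigo ring lra zify.

(** Write k for the length of the unique cycle of G. A graph with a cycle is not
    P_4 or P_5, and the complement of P_5 has two cycles, so the right-hand side
    of the equivalence always holds; everything rests on upper bounds for q(G)
    and q(G^c). Distinct eigenspaces are independent, so a matrix of order n with
    two eigenvalues of geometric multiplicities m and m' has at most
    n - m - m' + 2 eigenvalues ([q_mx_le_rank2]): it suffices to find matrices
    with two large eigenspaces.

    Every unicyclic graph arises from its cycle by adding vertices with at most
    one earlier neighbour ([sole_cycle_grows]), and both kinds of matrices are
    carried along this process.

    For G itself ([q_sole_cycle_le]): the cycle of length k >= 4 with a minus sign
    on one edge has the double eigenvalues 2cos(pi/k) and 2cos(3pi/k), the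
    eigenvectors being antiperiodic sines and cosines. A leaf is added by two
    rank one matrices, one for each of the two eigenvalues, that share their
    off-diagonal entries; this works if one carries a pencil A, A - E with an
    arbitrary positive diagonal matrix E. Hence q(G) <= n - 2. For k = 3 only the
    first eigenvalue is double, and q(G) <= n - 1.

    For G^c: assign to the vertices vectors of a d-dimensional space that are
    orthogonal exactly along the edges of G. Their Gram matrix belongs to S(G^c)
    and has rank at most d. If no two vectors are parallel, a leaf at u receives a
    generic vector orthogonal to that of u ([orth_rep_grows]), so only the cycle
    needs explicit vectors. For k >= 5 these exist with d = 3, which gives
    q(G^c) <= d + 1 = 4 ([q_compl_long_cycle]).

    For k = 4 the dimension must be 4 in general, and for k = 3 the bound needed is
    q(G^c) <= 3. In both cases q(G^c) <= d is obtained by rescaling the vectors x_i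
    so that the sum of the x_i^T x_i has a double eigenvalue. Choose three vertices
    a, b, c, let N be the contribution of the others and T = (1 - N)^-1. The
    eigenvalue 1 has multiplicity 2 as soon as the matrix of the products
    x_i T x_j^T over {a, b, c} minus the inverse weights has rank one; the weights
    only enter the diagonal, and a rank one matrix is determined by its nonzero
    off-diagonal entries, so the weights can be solved for, and are positive under
    three inequalities ([triple_cond]). These are open conditions, so vertices
    other than a few may be given tiny weights ([q_compl_le_triple]). They hold in
    particular if the three products are nonzero with negative product
    ([q_compl_le_obtuse]).

    For k = 4 a vertex outside the cycle and two opposite cycle vertices form such
    a triple; without outside vertices q(G^c) <= |G| = 4.
    For k = 3 the triangle itself does if some vertex w is not adjacent to it and
    w keeps a definite weight; otherwise all other vertices are leaves on the
    triangle, and two leaves at the same vertex or three leaves at distinct ones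
    provide a triple. What remains is the triangle, the triangle with one leaf,
    whose complement has an adjacency matrix of rank 2, and the triangle with
    leaves at two vertices, which is T_{2,2}. *)

Set Implicit Arguments.
Unset Strict Implicit.
Unset Printing Implicit Defensive.

Import Order.TTheory GRing.Theory Num.Theory.

(** * Eigenvalue counts and ranks *)

Section Spectrum.
Local Open Scope ring_scope.
Variable R : realType.

(** Eigenspaces for distinct eigenvalues are in direct sum. *)
Lemma sum_corank_le n (A : 'M[R]_n) (s : seq R) : uniq s ->
  (\sum_(a <- s) (n - \rank (A - a%:M)%R) <= n)%N.
Proof.
move=> us.
have inj : {in predT &, injective (fun i : 'I_(size s) => s`_i)}.
  by move=> i j _ _ /eqP; rewrite nth_uniq // => /eqP /val_inj.
have /mxdirectP /= := mxdirect_sum_eigenspace A inj.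
rewrite (big_nth 0) big_mkord => sumE.
under eq_bigr do rewrite -mxrank_ker.
rewrite -[X in (X <= _)%N]sumE; exact: rank_leq_row.
Qed.

Lemma eigs_of n (A : 'M[R]_n) : exists2 s : seq R, uniq s /\ size s = q_mx A &
  forall a, (a \in s) = (\rank (A - a%:M)%R < n)%N.
Proof.
exists (fset_set (classical_sets.mkset (fun a : R => eigenvalue A a))).
  by split; [exact: fset_uniq|].
move=> a; rewrite in_fset_set; last exact: finite_eigenvalues.
rewrite [RHS]ltn_neqAle rank_leq_row andbT -[_ == n]/(row_free _) -kermx_eq0.
exact: asboolb.
Qed.

Lemma q_mx_le_order n (A : 'M[R]_n) : (q_mx A <= n)%N.
Proof.
have [s [us <-] sP] := eigs_of A.
apply: leq_trans (sum_corank_le A us); rewrite -sum1_size.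
rewrite big_seq [X in (_ <= X)%N]big_seq; apply: leq_sum => a.
by rewrite sP subn_gt0.
Qed.

Lemma q_mx_le_rank n (A : 'M[R]_n) : (q_mx A <= \rank A + 1)%N.
Proof.
have [s [us <-] sP] := eigs_of A.
have u0 : uniq (0 :: rem 0 s) by rewrite /= rem_uniq // mem_rem_uniqF.
have sz : (size s <= size (0%R :: rem 0%R s))%N.
  by rewrite /=; case: (boolP (0%R \in s)) => [/size_rem ->|/rem_id ->] //; case: (size s).
have := sum_corank_le A u0; rewrite big_cons raddf0 subr0.
have : (size (rem 0%R s) <= \sum_(a <- rem 0%R s) (n - \rank (A - a%:M)%R))%N.
  rewrite -sum1_size big_seq [X in (_ <= X)%N]big_seq; apply: leq_sum => a.
  by move/mem_rem; rewrite sP subn_gt0.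
move: sz (rank_leq_row A) => /=; lia.
Qed.

(** Each eigenvalue other than [a] and [b] takes at least one of the dimensions
    that the eigenspaces of [a] and [b] leave free. *)
Lemma q_mx_le_rank2 n (A : 'M[R]_n) (a b : R) : a != b ->
  (q_mx A + n <= \rank (A - a%:M)%R + \rank (A - b%:M)%R + 2)%N.
Proof.
move=> ab; have [s [us <-] sP] := eigs_of A.
pose t := [seq x <- s | (x != a) && (x != b)].
have ut : uniq [:: a, b & t].
  by rewrite /= inE negb_or ab !mem_filter !eqxx !andbF /= filter_uniq.
have sz : (size s <= (size t).+2)%N.
  apply: (@uniq_leq_size _ s [:: a, b & t]) us _ => x xs.
  by rewrite !inE mem_filter xs andbT; case: eqP => //; case: eqP.
have := sum_corank_le A ut; rewrite !big_cons.
have : (size t <= \sum_(a <- t) (n - \rank (A - a%:M)%R))%N.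
  rewrite -sum1_size big_seq [X in (_ <= X)%N]big_seq; apply: leq_sum => x.
  by rewrite mem_filter sP subn_gt0 => /andP[].
move: sz (rank_leq_row (A - a%:M)) (rank_leq_row (A - b%:M)) => /=; lia.
Qed.

Lemma q_graph_le n (G : sgraph n) (A : 'M[R]_n) :
  S_graph G A -> (q_graph R G <= q_mx A)%N.
Proof.
move=> SA; rewrite /q_graph; case: ex_minnP => k _; apply.
by apply/asboolP; exists A.
Qed.

Lemma q_graph_le_order n (G : sgraph n) : (q_graph R G <= n)%N.
Proof.
rewrite /q_graph; case: ex_minnP => k /asboolP[A _ <-] _; exact: q_mx_le_order.
Qed.

Lemma row_free_ker m n (A : 'M[R]_(m, n)) :
  (forall v : 'rV_m, v *m A = 0 -> v = 0) -> row_free A.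
Proof.
by move=> A0; rewrite -kermx_eq0; apply/rowV0P => v /sub_kermxP /A0.
Qed.

Lemma rank_mul0_le n p (K : 'M[R]_(p, n)) (A : 'M[R]_n) : row_free K ->
  K *m A = 0 -> (p + \rank A <= n)%N.
Proof. by move=> /eqP fK /mulmx0_rank_max; rewrite fK. Qed.

End Spectrum.

(** * Cycles, and growth of a graph by leaves *)

Section Structure.
Variables (n : nat) (G : sgraph n).

(** A cycle determines its sequence of vertices only up to rotation and
    reversal. Uniqueness is used through vertex sets alone, which do not depend
    on that choice. *)
Definition sole_cycle (c : seq 'I_n) : Prop :=
  [/\ 2 < size c, ucycle G c &
      forall c', ucycle G c' -> 2 < size c' -> c' =i c].

Lemma edges_support (c : seq 'I_n) x :
  (x \in c) = [exists e in [set [set x; next c x] | x in c], x \in e].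
Proof.
apply/idP/existsP => [xc|[e /andP[/imsetP[y yc ->]]]].
  exists [set x; next c x]; rewrite set21 andbT; by apply/imsetP; exists x.
by rewrite !inE => /orP[/eqP -> //|/eqP ->]; rewrite mem_next.
Qed.

Lemma unicyclic_sole_cycle : unicyclic G -> exists c, sole_cycle c.
Proof.
case=> C [[c [sc Gc ->]] Cuniq]; exists c; split=> // c' Gc' sc' x.
by rewrite !edges_support (Cuniq [set [set x; next c' x] | x in c']) //; exists c'.
Qed.

Definition cyc_adj (k i j : nat) : bool :=
  [|| i.+1 == j, j.+1 == i, (i == 0) && (j.+1 == k) | (j == 0) && (i.+1 == k)].

Definition few_nbrs (S : {set 'I_n}) (w : 'I_n) : Prop :=
  forall u v, u \in S -> v \in S -> G w u -> G w v -> u = v.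

(** Induction on this predicate carries a construction from the subgraph induced
    on [S] to the whole graph, one leaf or isolated vertex at a time. *)
Inductive grows (S : {set 'I_n}) : Prop :=
| grows_all of S = setT
| grows_add w of w \notin S & few_nbrs S w & grows (w |: S).

(** The order of construction is found backwards, by peeling off from the whole
    graph vertices outside [S0] that are leaves or isolated in what remains. *)
Lemma grows_of_leaves (S0 : {set 'I_n}) :
    (forall S : {set 'I_n}, S0 \proper S ->
       exists w, [/\ w \in S, w \notin S0 & few_nbrs S w]) ->
  grows S0.
Proof.
move=> leaf; suff H (S : {set _}) : S0 \subset S -> grows S -> grows S0.
  by apply: (H setT); [exact: subsetT|exact: grows_all].
have [m] := ubnP #|S|; elim: m S => // m IH S Sm; rewrite subEproper.
case/predU1P => [->//|S0S] gS; have [w [wS wS0 few]] := leaf S S0S.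
apply: (IH (S :\ w)).
- by rewrite (cardsD1 w S) wS in Sm.
- by rewrite subsetD1 proper_sub.
- apply: (@grows_add _ w); rewrite ?setD1K ?setD11 //.
  by move=> u v /setD1P[_ uS] /setD1P[_ vS]; apply: few.
Qed.

Variable c : seq 'I_n.
Hypothesis c_sole : sole_cycle c.

Lemma sole_cycle_absurd c' x : ucycle G c' -> 2 < size c' -> x \in c' -> x \in c.
Proof. by case: c_sole => _ _ cP Gc' sc'; rewrite -(cP _ Gc' sc'). Qed.

(** A chord would cut off a cycle with fewer vertices. *)
Lemma cycle_chordless x0 i j : i < size c -> j < size c ->
  G (nth x0 c i) (nth x0 c j) = cyc_adj (size c) i j.
Proof.
wlog ij : i j / i < j.
  move=> W ic jc; case: (ltngtP i j) => [ij|ji|->]; first exact: W.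
    rewrite adj_sym W // /cyc_adj; lia.
  rewrite adj_irr /cyc_adj; case: c_sole; lia.
move=> ic jc; have [sc /andP[cyc uc] cP] := c_sole.
have Gnext k : k.+1 < size c -> G (nth x0 c k) (nth x0 c k.+1).
  case: (c) cyc => // a s; rewrite (cycle_path x0) /= => /andP[_ /(pathP x0) P] ks.
  exact: P.
have Glast : G (nth x0 c (size c).-1) (nth x0 c 0).
  case: (c) sc cyc => // a s _; rewrite (cycle_path x0) /= => /andP[].
  by rewrite (last_nth x0).
apply/idP/idP => [Gij|]; last first.
  rewrite /cyc_adj => /or4P[/eqP <-|/eqP jj|/andP[/eqP -> /eqP jk]|/andP[/eqP j0 _]].
  - by apply: Gnext; lia.
  - lia.
  - by rewrite adj_sym; move: Glast; rewrite -jk.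
  - lia.
rewrite /cyc_adj; case: (eqVneq i.+1 j) => //= i1j.
(* The part of c from position i to position j, closed by the chord. *)
pose c' := take (j - i).+1 (drop i c).
have sc' : size c' = (j - i).+1 by rewrite size_take size_drop; case: ltnP; lia.
have nc' k : k <= j - i -> nth x0 c' k = nth x0 c (i + k).
  by move=> kij; rewrite nth_take ?nth_drop.
have Gc' : ucycle G c'.
  apply/andP; split; last by rewrite take_uniq // drop_uniq.
  rewrite (cycle_path x0).
  have -> : c' = nth x0 c' 0 :: behead c' by case: (c') sc'.
  have -> : last x0 (nth x0 c' 0 :: behead c') = nth x0 c' (j - i).
    by case: (c') sc' => //= a s [<-]; rewrite (last_nth x0).
  rewrite /= !nc' // addn0 subnKC ?(ltnW ij) // [X in X && _]adj_sym Gij /=.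
  apply/(pathP x0) => k; rewrite size_behead sc' /= => kij.
  rewrite nth_behead nc' //; case: k kij => [|k] kij /=.
    by rewrite addn1; apply: Gnext; lia.
  by rewrite nth_behead nc' 1?ltnW // (addnS i k.+1); apply: Gnext; lia.
have cc' := cP _ Gc'; rewrite sc' in cc'.
have /eqP : size c' = size c.
  by apply/eqP; rewrite -uniq_size_uniq //; [case/andP: Gc'|move=> x; rewrite cc' //; lia].
by rewrite sc'; lia.
Qed.

(** The two ends of a one-vertex path coincide, so two ways of joining it to the
    cycle are recorded; otherwise one way for the head is enough. *)
Definition from_cycle_path (S : {set 'I_n}) (e x : 'I_n) (p : seq 'I_n) : Prop :=
  [/\ path G x p, uniq (x :: p), {subset x :: p <= [predD S & c]}, last x p = e &
    exists2 y, y \in c /\ G x y &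
      p = [::] -> exists z, [/\ z \in c, z != y & G x z]].

(** The head of a longest path has a neighbour beyond its successor; it cannot
    lie on the path, which would close a cycle, so it lies on [c]. *)
Lemma path_reaches_cycle (S : {set 'I_n}) (x : 'I_n) (p : seq 'I_n) :
    (forall w, w \in S -> w \notin c -> ~ few_nbrs S w) ->
    path G x p -> uniq (x :: p) -> {subset x :: p <= [predD S & c]} ->
  exists x' p', from_cycle_path S (last x p) x' p'.
Proof.
(* The path gets longer at each step, up to n vertices. *)
move=> dense; have [m] := ubnP (n - size p).
elim: m x p => // m IH x p mp xp up sp.
have /andP[xc xS] : x \in [predD S & c] by apply: sp; rewrite mem_head.
have [u [v [uS vS xu xv uv]]] : exists u v, [/\ u \in S, v \in S, G x u, G x v & u != v].
  apply: contrapT => nuv; apply: (dense x xS xc) => u v uS vS xu xv.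
  by apply: contrapT => /eqP uv; apply: nuv; exists u, v.
have step z : z \in S -> G x z -> z \notin c -> z != head x p ->
  exists x' p', from_cycle_path S (last x p) x' p'.
  move=> zS xz zc zp; have zx : z != x by apply: contraTneq xz => ->; rewrite adj_irr.
  have [zinp|zNp] := boolP (z \in p).
    exfalso; case/splitPr: zinp xp up zp sp => -[|a p1] p2 xp up zp sp /=.
      by rewrite /= eqxx in zp.
    suff : x \in c by rewrite (negbTE xc).
    apply: (@sole_cycle_absurd (x :: rcons (a :: p1) z)); rewrite ?mem_head //=.
      apply/andP; split.
        move: xp; rewrite -cat_rcons cat_path => /andP[xp _].
        rewrite (cycle_path x) /= last_rcons adj_sym xz; exact: xp.
      by move: up; rewrite -cat_rcons -cat_cons cat_uniq => /andP[].
    by rewrite size_rcons.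
  have [] // := IH z (x :: p).
  - have : uniq (z :: x :: p) by rewrite cons_uniq inE negb_or zx zNp.
    move/card_uniqP => szp; have := max_card (mem (z :: x :: p)).
    rewrite szp card_ord /= => h; move: mp h; clear; lia.
  - by rewrite /= adj_sym xz.
  - by rewrite cons_uniq inE negb_or zx zNp.
  - by move=> w; rewrite inE => /orP[/eqP -> /=|/sp//]; rewrite inE zc.
  - by move=> x1 H; exists x1.
case: p mp xp up sp step => [|a p] mp xp up sp step.
  have [uc|uc] := boolP (u \in c); last first.
    by apply: (step u) => //; apply: contraTneq xu => ->; rewrite adj_irr.
  have [vc|vc] := boolP (v \in c); last first.
    by apply: (step v) => //; apply: contraTneq xv => ->; rewrite adj_irr.
  exists x, [::]; split=> //; exists u => // _; exists v; split=> //.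
  by rewrite eq_sym.
have [z [zS xz za]] : exists z, [/\ z \in S, G x z & z != a].
  by have [ua|ua] := eqVneq u a; [exists v; rewrite -ua eq_sym|exists u].
have [zc|zc] := boolP (z \in c); last exact: (step z).
by exists x, (a :: p); split=> //; exists z.
Qed.

(** Otherwise a path outside [c], prolonged at both ends, would be joined to [c]
    at both ends. Together with an arc of [c] (or with the common end point) it
    would form a second cycle. *)
Lemma cycle_leaf_outside (S : {set 'I_n}) :
    {subset c <= S} -> ~ {subset S <= c} ->
  exists w, [/\ w \in S, w \notin c & few_nbrs S w].
Proof.
move=> cS Sc; apply: contrapT => nex.
have dense w : w \in S -> w \notin c -> ~ few_nbrs S w.
  by move=> wS wc few; apply: nex; exists w.
have [w wS wc] : exists2 w, w \in S & w \notin c.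
  apply: contrapT => nw; apply: Sc => x xS; apply: contrapT => /negP xc.
  by apply: nw; exists x.
have [] := @path_reaches_cycle S w [::] dense; rewrite //=.
  by move=> y; rewrite inE => /eqP ->; rewrite inE /= wc.
move=> x1 [p1 [xp1 up1 sp1 _ [y1 [y1c xy1] _]]].
(* Prolong the reversed path, whose last vertex is already joined to c. *)
have [] := @path_reaches_cycle S (last x1 p1) (rev (belast x1 p1)) dense.
- by rewrite rev_path; under eq_path do rewrite adj_sym.
- by rewrite -rev_rcons -lastI rev_uniq.
- by move=> y; rewrite -rev_rcons -lastI mem_rev; apply: sp1.
rewrite (_ : last (last x1 p1) _ = x1); last first.
  by case: (p1) => //= a p; rewrite rev_cons last_rcons.
move=> x [p [xp up sp lp [y [yc xy] py]]].
have {y1 y1c xy1 py} [y1 [y1c xy1 yp]] :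
    exists y1, [/\ y1 \in c, G (last x p) y1 & y = y1 -> p != [::]].
  have [pN|pN] := eqVneq p [::]; last by exists y1; rewrite lp.
  have [z [zc zy xz]] := py pN.
  by exists z; rewrite pN; split=> // yz; rewrite yz eqxx in zy.
have xNc u : u \in x :: p -> u \notin c by move=> /sp /andP[].
have xc' : x \notin c by apply: xNc; rewrite mem_head.
suff : x \in c by rewrite (negbTE xc').
have [yy1|yy1] := eqVneq y y1.
  apply: (@sole_cycle_absurd (y :: x :: p)); last by rewrite inE mem_head orbT.
    apply/andP; split.
      by rewrite (cycle_path x) /= yy1 xy1 -yy1 adj_sym xy.
    by rewrite cons_uniq up andbT; apply: contraL yc => /xNc.
  by case: (p) (yp yy1).
have [sc /andP[cyc uc] _] := c_sole.
case/rot_to: yc => i c1 rc.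
have y1c1 : y1 \in c1.
  have : y1 \in rot i c by rewrite mem_rot.
  by rewrite rc inE eq_sym (negbTE yy1).
have ycyc : cycle G (y :: c1) by rewrite -rc rot_cycle.
have ucyc : uniq (y :: c1) by rewrite -rc rot_uniq.
have subc1 u : u \in y :: c1 -> u \in c by rewrite -rc mem_rot.
case/splitPr: y1c1 ycyc ucyc subc1 => d1 d2; rewrite -cat_rcons => ycyc ucyc subc1.
apply: (@sole_cycle_absurd (y :: rcons d1 y1 ++ rev (x :: p))); last first.
- by rewrite inE mem_cat mem_rev mem_head !orbT.
- by rewrite /= size_cat size_rcons size_rev /= !addnS.
apply/andP; split; last first.
  rewrite -cat_cons cat_uniq rev_uniq up andbT.
  move: ucyc; rewrite -cat_cons cat_uniq => /andP[-> _] /=.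
  apply/hasPn => u; rewrite mem_rev => /xNc; apply: contra => uy; apply: subc1.
  by rewrite -cat_cons mem_cat uy.
move: ycyc; rewrite !(cycle_path x) /= !cat_path.
move=> /and3P[_ yd _]; rewrite yd last_cat last_rcons.
rewrite [x :: p]lastI rev_rcons /= [G y1 _]adj_sym xy1 rev_path.
rewrite (_ : last _ _ = x) ?[G x y]xy /=; last first.
  by case: (p) => //= a q; rewrite rev_cons last_rcons.
by under eq_path do rewrite adj_sym.
Qed.

Lemma sole_cycle_grows : grows [set x in c].
Proof.
apply: grows_of_leaves => S /properP[cS [x xS xc]].
have [|Sc|w [wS wc few]] := @cycle_leaf_outside S.
- by move=> u uc; apply: (subsetP cS); rewrite inE.
- by rewrite inE Sc in xc.
- by exists w; rewrite inE.
Qed.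

End Structure.

(** * Matrices of a unicyclic graph with two multiple eigenvalues *)

Local Open Scope ring_scope.

Section SignedCycle.
Variable R : realType.

(** The sign of the closing edge makes the eigenvectors antiperiodic. Without it
    the cycle of length 4 would have a single double eigenvalue. *)
Definition signed_cycle k : 'M[R]_k :=
  \matrix_(i, j) ((i.+1 == j)%:R + (j.+1 == i)%:R
     - ((i == 0%N :> nat) && (j.+1 == k))%:R - ((j == 0%N :> nat) && (i.+1 == k))%:R).

Lemma signed_cycle_sym k : (signed_cycle k)^T = signed_cycle k.
Proof. by apply/matrixP => i j; rewrite !mxE; ring. Qed.

Lemma signed_cycle_neq0 k (i j : 'I_k) : (2 < k)%N ->
  (signed_cycle k i j != 0) = cyc_adj k i j.
Proof.
move=> k3; rewrite mxE /cyc_adj.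
case: (i.+1 =P j) => ij; case: (j.+1 =P i) => ji; case: (i =P 0%N :> nat) => i0;
  case: (j.+1 =P k) => jk; case: (j =P 0%N :> nat) => j0; case: (i.+1 =P k) => ik //=;
  try (exfalso; lia); by rewrite ?subr0 ?addr0 ?add0r ?sub0r ?oppr_eq0 ?oner_eq0 ?eqxx.
Qed.

Lemma sum_pick k (f : nat -> R) m :
  \sum_(i < k) f i * (i == m :> nat)%:R = if (m < k)%N then f m else 0.
Proof.
case: ltnP => mk.
  rewrite (bigD1 (Ordinal mk)) //= eqxx mulr1 big1 ?addr0 // => i /negPf im.
  by rewrite (_ : (i == m :> nat) = false) ?mulr0.
apply: big1 => i _; rewrite (_ : (i == m :> nat) = false) ?mulr0 //.
by apply/negP => /eqP im; move: (ltn_ord i); rewrite im ltnNge mk.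
Qed.

(** For an antiperiodic sequence the recurrence continues across the closing edge
    with exactly the sign that this edge carries. *)
Lemma signed_cycle_eigen k (f : nat -> R) (a : R) : (2 < k)%N ->
  (forall i, f i + f i.+2 = a * f i.+1) -> f k = - f 0%N -> f k.+1 = - f 1%N ->
  (\row_(j < k) f j) *m signed_cycle k = a *: \row_j f j.
Proof.
move=> k3 rec fk fk1; apply/rowP => j; rewrite !mxE.
under eq_bigr do rewrite !mxE.
have jk := ltn_ord j.
have E (i : 'I_k) : f i * ((i.+1 == j)%:R + (j.+1 == i)%:R
     - ((i == 0%N :> nat) && (j.+1 == k))%:R - ((j == 0%N :> nat) && (i.+1 == k))%:R)
   = (0 < j)%:R * (f i * (i == j.-1 :> nat)%:R) + f i * (i == j.+1 :> nat)%:R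
     - (j.+1 == k)%:R * (f i * (i == 0%N :> nat)%:R)
     - (j == 0%N :> nat)%:R * (f i * (i == k.-1 :> nat)%:R).
  have -> : (i.+1 == j) = (0 < j)%N && (i == j.-1 :> nat) by lia.
  have -> : (i.+1 == k) = (i == k.-1 :> nat) by lia.
  by rewrite [j.+1 == i]eq_sym -!mulnb !natrM; ring.
under eq_bigr do rewrite E.
rewrite !big_split /= !sumrN -!mulr_sumr !sum_pick.
have -> : (0 < k)%N by lia.
have -> : (k.-1 < k)%N by lia.
have -> : (j.-1 < k)%N by lia.
case: (posnP j) => [->|j0].
  have -> : (1 < k)%N by lia.
  have -> : (1 == k) = false by lia.
  have := rec k.-1; rewrite !prednK; [|lia..]; rewrite fk fk1 => e.
  rewrite /=; lra.
have := rec j.-1; rewrite !prednK // => e.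
case: (eqVneq j.+1 k) => [jk1|jk1].
  move: e; rewrite jk1 fk ltnn /=; lra.
have -> : (j.+1 < k)%N by lia.
rewrite /=; lra.
Qed.

Lemma sin_cos_rec (t : R) i :
  cos (i%:R * t) + cos (i.+2%:R * t) = 2 * cos t * cos (i.+1%:R * t) /\
  sin (i%:R * t) + sin (i.+2%:R * t) = 2 * cos t * sin (i.+1%:R * t).
Proof.
have -> : i%:R * t = i.+1%:R * t - t by rewrite -(natr1 i); ring.
have -> : i.+2%:R * t = i.+1%:R * t + t by rewrite -(natr1 i.+1); ring.
by rewrite cosB cosD sinB sinD; split; ring.
Qed.

Lemma signed_cycle_rank k (t : R) : (2 < k)%N ->
    cos (k%:R * t) = -1 -> sin (k%:R * t) = 0 ->
  (\rank (signed_cycle k - (2 * cos t)%:M)%R + 1 <= k)%N /\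
  (sin t != 0 -> (\rank (signed_cycle k - (2 * cos t)%:M)%R + 2 <= k)%N).
Proof.
move=> k3 ck sk.
pose C := \row_(j < k) cos (j%:R * t); pose S := \row_(j < k) sin (j%:R * t).
have k1t : k.+1%:R * t = k%:R * t + t by rewrite -natr1; ring.
have eC : C *m (signed_cycle k - (2 * cos t)%:M) = 0.
  rewrite mulmxBr mul_mx_scalar (@signed_cycle_eigen k (fun j => cos (j%:R * t)) (2 * cos t))
      ?subrr //.
  - by move=> i; have [] := sin_cos_rec t i.
  - by rewrite mul0r cos0 ck.
  - by rewrite k1t cosD ck sk mul1r; ring.
have eS : S *m (signed_cycle k - (2 * cos t)%:M) = 0.
  rewrite mulmxBr mul_mx_scalar (@signed_cycle_eigen k (fun j => sin (j%:R * t)) (2 * cos t))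
      ?subrr //.
  - by move=> i; have [] := sin_cos_rec t i.
  - by rewrite mul0r sin0 sk oppr0.
  - by rewrite k1t sinD ck sk mul1r; ring.
have i0 : 'I_k by exists 0%N; lia.
have [k0 k1] : (0 < k)%N /\ (1 < k)%N by lia.
split=> [|st].
  rewrite addnC; apply: (@rank_mul0_le _ _ _ C) => //; apply: row_free_ker => v.
  move/rowP/(_ (Ordinal k0)); rewrite !mxE big_ord1 !mxE mul0r cos0 mulr1 => v0.
  by apply/rowP => i; rewrite ord1 v0 mxE.
rewrite addnC; apply: (@rank_mul0_le _ _ _ (col_mx C S)); last first.
  by rewrite mul_col_mx eC eS col_mx0.
apply: row_free_ker => v; rewrite -[v]hsubmxK mul_row_col => /rowP H.
have := H (Ordinal k0); have := H (Ordinal k1).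
rewrite !mxE !big_ord1 !mxE /= !mul0r !mul1r sin0 cos0 mulr0 addr0 mulr1 => H1 H0.
move: H1; rewrite H0 mul0r add0r => /eqP; rewrite mulf_eq0 (negPf st) orbF => /eqP H1.
have -> : lsubmx v = 0 by apply/rowP => i; rewrite ord1 [RHS]mxE -H0 mxE.
have -> : rsubmx v = 0 by apply/rowP => i; rewrite ord1 [RHS]mxE -H1 mxE.
by rewrite row_mx0.
Qed.

(** For t = pi/k the angles t and 3t both give antiperiodic solutions; an affine
    map moves the eigenvalues 2cos t and 2cos 3t to 0 and 1. For k = 3 the second
    angle is pi, where the sine solution vanishes. *)
Lemma signed_cycle_pencil k : (2 < k)%N ->
  exists B : 'M[R]_k, [/\ B^T = B, forall i j, i != j -> (B i j != 0) = cyc_adj k i j,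
    (\rank B + 2 <= k)%N & (\rank (B - 1%:M)%R + (if k == 3 then 1 else 2) <= k)%N].
Proof.
move=> k3; have k0 : (0 : R) < k%:R by rewrite ltr0n; lia.
have kn0 : k%:R != 0 :> R by rewrite gt_eqF.
pose t : R := pi / k%:R; have kt : k%:R * t = pi by rewrite /t mulrCA divff ?mulr1.
have p0 := pi_gt0 R.
have t0 : 0 < t by rewrite divr_gt0.
have t3 : 3 * t <= pi by rewrite -kt ler_pM2r // ler_nat.
have s1 : sin t != 0 by rewrite gt_eqF // sin_gt0_pi // t0; move: t0 t3 p0; lra.
have c1 : cos (k%:R * t) = -1 by rewrite kt cospi.
have sk1 : sin (k%:R * t) = 0 by rewrite kt sinpi.
have [_ /(_ s1) r1] := signed_cycle_rank k3 c1 sk1.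
have kt3 : k%:R * (3 * t) = pi *+ 3 by rewrite mulrCA kt mulr_natl.
have c3 : cos (k%:R * (3 * t)) = -1.
  by rewrite kt3 mulrSr cosD -mulr_natr mulr_natr cos2pi sin2pi cospi; ring.
have s3 : sin (k%:R * (3 * t)) = 0.
  by rewrite kt3 mulrSr sinD cos2pi sin2pi sinpi; ring.
have [r2 r2'] := signed_cycle_rank k3 c3 s3.
pose l1 := 2 * cos t; pose l2 := 2 * cos (3 * t).
have l12 : l1 - l2 != 0.
  rewrite subr_eq0 /l1 /l2; apply/eqP => /mulfI; rewrite pnatr_eq0 => /(_ isT) /cos_inj.
  rewrite !in_itv /=; lra.
exists ((l1 - l2)^-1 *: (l1%:M - signed_cycle k)).
have rN (a : R) : \rank ((l1 - l2)^-1 *: (a%:M - signed_cycle k)) = \rank (signed_cycle k - a%:M).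
  by rewrite -[a%:M - _]opprB scalerN -scaleNr; apply: eqmx_rank; apply/eqmxP;
      apply: eqmx_scale; rewrite oppr_eq0 invr_eq0.
split.
- by rewrite linearZ /= linearB /= tr_scalar_mx signed_cycle_sym.
- move=> i j /negPf ij; rewrite -signed_cycle_neq0 // !mxE ij mulr0n sub0r.
  by rewrite mulf_eq0 invr_eq0 (negPf l12) oppr_eq0.
- by rewrite rN.
have -> : (l1 - l2)^-1 *: (l1%:M - signed_cycle k) - 1%:M =
    (l1 - l2)^-1 *: (l2%:M - signed_cycle k).
  have -> : 1%:M = (l1 - l2)^-1 *: ((l1 - l2)%:M) :> 'M[R]_k by rewrite scale_scalar_mx mulVf.
  by rewrite -scalerBr; congr (_ *: _); rewrite [(l1 - l2)%:M]raddfB /=; apply/matrixP => i j;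
      rewrite !mxE; ring.
rewrite rN; case: eqP => // k3'; apply: r2'.
rewrite gt_eqF // sin_gt0_pi // mulr_gt0 //=.
rewrite -kt ltr_pM2r // ltr_nat; lia.
Qed.

End SignedCycle.

Section Pencil.
Variables (R : realType) (n : nat) (G : sgraph n).

Definition pattern_on (S : {set 'I_n}) (A : 'M[R]_n) : Prop :=
  A^T = A /\ forall i j, i != j -> (A i j != 0) = [&& i \in S, j \in S & G i j].

Definition diag_on (S : {set 'I_n}) (E : 'I_n -> R) : 'M[R]_n :=
  \matrix_(i, j) if (i == j) && (i \in S) then E i else 0.

(** Carrying an arbitrary positive diagonal [E] rather than the identity leaves
    room to modify the diagonal at the neighbour of a new leaf. *)
Definition pencil (m : nat) (S : {set 'I_n}) : Prop :=
  forall E : 'I_n -> R, (forall i, 0 < E i) ->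
  exists A, [/\ pattern_on S A, (\rank A + 2 <= #|S|)%N &
                (\rank (A - diag_on S E)%R + m <= #|S|)%N].

Section SelectMatrix.
Variables (x0 : 'I_n) (c : seq 'I_n).
Hypothesis uc : uniq c.

Definition select_mx : 'M[R]_(size c, n) := \matrix_(a, j) (nth x0 c a == j)%:R.

(** Congruence by [select_mx] spreads a matrix indexed by the positions of [c]
    over the vertices of the graph. *)
Lemma select_mxE (M : 'M[R]_(size c)) (a b : 'I_(size c)) :
  (select_mx^T *m M *m select_mx) (nth x0 c a) (nth x0 c b) = M a b.
Proof.
have pick (a' b' : 'I_(size c)) : (nth x0 c b' == nth x0 c a') = (b' == a').
  by rewrite nth_uniq.
have Fe a' j : select_mx a' j = (nth x0 c a' == j)%:R by rewrite mxE.
rewrite mxE (bigD1 b) //= Fe eqxx mulr1 big1 ?addr0 => [|b' b'b]; last first.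
  by rewrite Fe pick (negPf b'b) mulr0.
rewrite mxE (bigD1 a) //= mxE Fe eqxx mul1r big1 ?addr0 // => a' a'a.
by rewrite mxE Fe pick (negPf a'a) mul0r.
Qed.

Lemma select_mx_out (M : 'M[R]_(size c)) i j : ~~ ((i \in c) && (j \in c)) ->
  (select_mx^T *m M *m select_mx) i j = 0.
Proof.
have out (k : 'I_n) (a : 'I_(size c)) : k \notin c -> (nth x0 c a == k) = false.
  by apply: contraNF => /eqP <-; rewrite mem_nth.
have Fe a' k : select_mx a' k = (nth x0 c a' == k)%:R by rewrite mxE.
rewrite negb_and => /orP[ic|jc]; rewrite mxE; apply: big1 => b _.
  by rewrite mxE big1 ?mul0r // => a _; rewrite mxE Fe out ?mul0r.
by rewrite Fe out ?mulr0.
Qed.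

End SelectMatrix.

(** Congruence by the square root of [E] turns the pencil of [B] and 1 into one
    of [A] and [E], and does not increase ranks. *)
Lemma cycle_pencil c : sole_cycle G c ->
  pencil (if size c == 3 then 1 else 2) [set x in c].
Proof.
move=> c_sole E E0; have [sc /andP[_ uc] _] := c_sole.
have x0 : 'I_n by case: (c) sc.
have cE : #|[set x in c]| = size c by rewrite cardsE; apply/card_uniqP.
have [B [Bsym BE rB rB1]] := signed_cycle_pencil R sc.
pose k := size c; pose F := select_mx x0 c; rewrite cE.
pose D : 'M[R]_k := diag_mx (\row_a Num.sqrt (E (nth x0 c a))).
have rankF (M : 'M[R]_k) : (\rank (F^T *m (D *m M *m D) *m F) <= \rank M)%N.
  exact: leq_trans (mxrankM_maxl _ _) (leq_trans (mxrankM_maxr _ _)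
           (leq_trans (mxrankM_maxl _ _) (mxrankM_maxr _ _))).
have DE M a b : (D *m M *m D) a b =
    Num.sqrt (E (nth x0 c a)) * M a b * Num.sqrt (E (nth x0 c b)).
  by rewrite mul_mx_diag mxE mul_diag_mx !mxE.
have inc i : i \in c -> exists a : 'I_k, i = nth x0 c a.
  by move=> ic; have ik := ic; rewrite -index_mem in ik; exists (Ordinal ik);
      rewrite /= nth_index.
exists (F^T *m (D *m B *m D) *m F); split; [split| |].
- by rewrite !trmx_mul trmxK tr_diag_mx Bsym !mulmxA.
- move=> i j ij; rewrite !inE; have [/andP[ic jc]|ijc] := boolP ((i \in c) && (j \in c)).
    have [[a ia] [b jb]] := (inc i ic, inc j jc).
    have ab : a != b by apply: contraNneq ij => ab; rewrite ia jb ab.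
    rewrite ic jc ia jb select_mxE // DE (cycle_chordless c_sole) // -BE //.
    by rewrite !mulf_eq0 !sqrtr_eq0 !leNgt !E0 orbF.
  by rewrite select_mx_out // eqxx andbA (negPf ijc).
- by apply: leq_trans rB; rewrite leq_add2r.
have -> : diag_on [set x in c] E = F^T *m (D *m 1%:M *m D) *m F.
  apply/matrixP => i j; rewrite [LHS]mxE inE.
  have [/andP[ic jc]|ijc] := boolP ((i \in c) && (j \in c)).
    have [[a ia] [b jb]] := (inc i ic, inc j jc).
    rewrite ic ia jb select_mxE // DE nth_uniq // andbT [1%:M a b]mxE -(inj_eq val_inj) /=.
    have [ab|ab] := eqVneq (a : nat) b; last by rewrite mulr0 mul0r.
    by rewrite ab mulr1 -expr2 sqr_sqrtr // ltW.
  rewrite select_mx_out //; case: eqP => //= ij; case: ifP => // ic.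
  by rewrite -ij ic in ijc.
rewrite -mulmxBl -mulmxBr -mulmxBl -mulmxBr.
by apply: leq_trans rB1; rewrite leq_add2r.
Qed.

(** A leaf w at u with e = E w: on (u, w) the rank one blocks
    [e/2, e; e, 2e] and [e, e; e, e] are added to A and to A - E. They have the
    same off-diagonal entries; their diagonals differ by -e/2 at u and by e at w,
    which amounts to starting from E u + e/2 at u. *)
Lemma pencil_grow m (S : {set 'I_n}) w : (m <= 2)%N -> w \notin S -> few_nbrs G S w ->
  pencil m S -> pencil m (w |: S).
Proof.
move=> m2 wS few pS E E0; have e0 := E0 w.
have rk1 (r : 'I_n -> R) (A : 'M[R]_n) a :
    (\rank (A + \matrix_(i, j) (a * (r i * r j)))%R <= \rank A + 1)%N.
  apply: leq_trans (mxrank_add _ _) _; rewrite leq_add2l.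
  have -> : \matrix_(i, j) (a * (r i * r j)) = (\col_i (a * r i)) *m (\row_j r j).
    by apply/matrixP => i j; rewrite !mxE big_ord1 !mxE mulrA.
  exact: leq_trans (mxrankM_maxl _ _) (rank_leq_col _).
have cS : #|w |: S| = (#|S| + 1)%N by rewrite cardsU1 wS addnC.
have [[u uS wu]|nou] := pselect (exists2 u, u \in S & G w u); last first.
  have [A [[As AE] r1 r2]] := pS E E0; exists A; rewrite cS; split; [|lia|].
    have nw j : (j \in w |: S) && G w j = false.
      apply/negbTE/negP => /andP[/setU1P[->|jS] wj].
        by rewrite adj_irr in wj.
      by apply: nou; exists j.
    split=> // i j ij; rewrite AE //.
    have [iw|iw] := eqVneq i w; first by rewrite iw (negPf wS) setU11 nw.
    have [jw|jw] := eqVneq j w; last by rewrite !inE (negPf iw) (negPf jw).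
    by rewrite jw (negPf wS) setU11 adj_sym nw andbF.
  have -> : diag_on (w |: S) E = diag_on S E -
      \matrix_(i, j) (- E w * ((i == w)%:R * (j == w)%:R)).
    apply/matrixP => i j; rewrite !mxE !inE.
    have [->|iw] := eqVneq i w; last by rewrite mul0r mulr0 subr0.
    rewrite (negPf wS) eq_sym andbF; case: eqP => _ /=; ring.
  rewrite opprB addrA addrAC; have H := rk1 (fun i => (i == w)%:R) (A - diag_on S E) (- E w).
  by apply: leq_trans (leq_add H (leqnn m)) _; rewrite addnAC leq_add2r.
have uw : u != w by apply: contraNneq wS => <-.
have wu' : (w == u) = false by rewrite eq_sym (negPf uw).
pose e := E w; pose E' i := if i == u then E u + e / 2 else E i.
have E'0 i : 0 < E' i.
  by rewrite /E'; case: eqP => // _; rewrite addr_gt0 // divr_gt0.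
have [A [[As AE] r1 r2]] := pS E' E'0.
pose r i : R := (i == w)%:R + (i == u)%:R / 2.
(* The block e/2, e; e, 2e is 2e times the square of the row (1/2, 1). *)
exists (A + \matrix_(i, j) (2 * e * (r i * r j))); rewrite cS; split.
- split; first by apply/matrixP => i j; rewrite !mxE -[in LHS]As mxE [r j * _]mulrC.
  have Aw j : j != w -> A w j = 0.
    move=> jw; apply/eqP/negPn; rewrite AE ?(negPf wS) //.
    by rewrite eq_sym.
  have rowW j : j != w -> (A w j + 2 * e * (r w * r j) != 0) =
                          [&& w \in w |: S, j \in w |: S & G w j].
    move=> jw; rewrite Aw // /r eqxx (negPf jw) wu'.
    rewrite setU11 in_setU1 (negPf jw) /= add0r mul0r addr0 mul1r add0r.
    have [->|ju] := eqVneq j u.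
      rewrite uS wu (_ : 2 * e * _ = e) ?gt_eqF //=; by field.
    rewrite mul0r mulr0 eqxx; apply/esym/negbTE/negP => /andP[jS wj].
    by rewrite (few j u) ?eqxx in ju.
  move=> i j ij; rewrite !mxE.
  have [iw|iw] := eqVneq i w; first by rewrite iw rowW // eq_sym -iw.
  have [jw|jw] := eqVneq j w.
    by rewrite jw -[in LHS]As mxE [r i * _]mulrC rowW // andbCA adj_sym.
  rewrite !in_setU1 /r (negPf iw) (negPf jw) !add0r -AE //.
  have [iu|iu] := eqVneq i u; last by rewrite !mul0r mulr0 addr0.
  by rewrite -iu [j == i]eq_sym (negPf ij) !mul0r !mulr0 addr0.
- by apply: leq_trans (leq_add (rk1 r A (2 * e)) (leqnn 2)) _; rewrite addnAC leq_add2r.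
have -> : A + \matrix_(i, j) (2 * e * (r i * r j)) - diag_on (w |: S) E =
   A - diag_on S E' + \matrix_(i, j) (e * (((i == w)%:R + (i == u)%:R) * ((j == w)%:R + (j ==
       u)%:R))).
  apply/matrixP => i j; rewrite !mxE !inE /r /E'.
  have [iw|iw] := eqVneq i w; have [jw|jw] := eqVneq j w.
  - by rewrite iw jw eqxx wu' (negPf wS) /= /e; ring.
  - have [ij|ij] := eqVneq i j; first by rewrite -ij iw eqxx in jw.
    by rewrite iw wu' /=; case: eqP => _ /=; field.
  - have [ij|ij] := eqVneq i j; first by rewrite ij jw eqxx in iw.
    by rewrite jw wu' /=; case: eqP => _ /=; field.
  have [ij|ij] := eqVneq i j; rewrite /=.
    rewrite -ij; have [iu|iu] := eqVneq i u; last by case: ifP => _ /=; field.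
    by rewrite iu uS /=; field.
  have [iu|iu] := eqVneq i u; last by rewrite /=; field.
  by rewrite -iu [j == i]eq_sym (negPf ij) /=; field.
have H := rk1 (fun i => (i == w)%:R + (i == u)%:R) (A - diag_on S E') e.
by apply: leq_trans (leq_add H (leqnn m)) _; rewrite addnAC leq_add2r.
Qed.

Lemma pencil_grows m (S : {set 'I_n}) : (m <= 2)%N ->
  grows G S -> pencil m S -> pencil m setT.
Proof.
move=> m2; elim=> [{}S -> //|{}S w wS few _ IH pS].
exact/IH/pencil_grow.
Qed.

Lemma q_sole_cycle_le c : sole_cycle G c ->
  (q_graph R G + (if size c == 3 then 1 else 2) <= n)%N.
Proof.
move=> c_sole; set m := (if _ then _ else _).
have m2 : (m <= 2)%N by rewrite /m; case: ifP.
have [|A [[As AE]]] := pencil_grows m2 (sole_cycle_grows c_sole) (cycle_pencil c_sole) (E :=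
    fun _ => 1).
  by move=> _; exact: ltr01.
have -> : diag_on setT (fun=> 1) = 1%:M by apply/matrixP => i j; rewrite !mxE inE andbT;
    case: eqP.
rewrite cardsT card_ord => r1 r2.
have /q_graph_le qA : S_graph G A by split=> // i j ij; rewrite AE // !inE.
have /(q_mx_le_rank2 A) : (0 : R) != 1 by rewrite eq_sym oner_eq0.
have -> : A - 0%:M = A by rewrite raddf0 subr0.
move: qA r1 r2; move: (\rank _) (\rank _) (q_mx _) (q_graph _ _) => a b q q'; clear; lia.
Qed.

End Pencil.

(** * Orthogonal representations *)

Section Avoidance.
Variable R : realType.

Lemma fresh_scalar (ts : seq R) : exists t, t \notin ts.
Proof.
suff [t tP] : exists t, forall u, u \in ts -> u < t.
  by exists t; apply/negP => /tP; rewrite ltxx.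
elim: ts => [|u ts [t tP]]; first by exists 0.
exists (Num.max t (u + 1)) => v; rewrite inE lt_max => /predU1P[->|/tP -> //].
by rewrite ltrDl ltr01 orbT.
Qed.

Lemma avoid_scalars (T : eqType) (Ks : seq T) (bad : T -> R -> Prop) :
    (forall K, K \in Ks -> forall s t, bad K s -> bad K t -> s = t) ->
  exists t, forall K, K \in Ks -> ~ bad K t.
Proof.
move=> once; suff [t _ tP] : exists2 t, t \notin [::] & forall K, K \in Ks -> ~ bad K t.
  by exists t.
move: [::] => ts; elim: Ks once ts => [_ ts|K Ks IH once ts].
  by have [t tts] := fresh_scalar ts; exists t.
have once' K' : K' \in Ks -> forall s t, bad K' s -> bad K' t -> s = t.
  by move=> K'Ks; apply: once; rewrite inE K'Ks orbT.
have [[s Ks0]|nobad] := pselect (exists s, bad K s).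
  have [t] := IH once' (s :: ts); rewrite inE negb_or => /andP[ts' tts] tP.
  exists t => // K'; rewrite inE => /predU1P[-> /(once _ (mem_head _ _) _ _ Ks0) st|/tP //].
  by rewrite st eqxx in ts'.
have [t tts tP] := IH once' ts; exists t => // K'.
by rewrite inE => /predU1P[-> Kt|/tP //]; apply: nobad; exists t.
Qed.

(** A subspace over an infinite field is not covered by finitely many subspaces
    that do not contain it: a line through two points meets each of them at most
    once, unless both points lie in it. *)
Lemma avoid_subspaces d (L : 'M[R]_d) (Hs : seq 'M[R]_d) :
  (forall H, H \in Hs -> ~~ (L <= H)%MS) ->
  exists2 y : 'rV[R]_d, (y <= L)%MS & forall H, H \in Hs -> ~~ (y <= H)%MS.
Proof.
elim: Hs => [|H Hs IH] LH; first by exists 0; rewrite ?sub0mx.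
have [|y yL yH] := IH; first by move=> K KH; apply: LH; rewrite inE KH orbT.
have [z zL zH] : exists2 z : 'rV_d, (z <= L)%MS & ~~ (z <= H)%MS.
  have /row_subPn[i iH] := LH H (mem_head _ _).
  by exists (row i L); rewrite ?row_sub.
have [|t tP] := @avoid_scalars _ (H :: Hs) (fun K t => is_true ((y + t *: z)%R <= K)%MS).
  move=> K KH s t ys yt; apply: contrapT => /eqP st.
  have zK : (z <= K)%MS.
    have : (((s - t) *: z)%R <= K)%MS.
      have -> : (s - t) *: z = (y + s *: z) - (y + t *: z).
        by rewrite opprD addrACA subrr add0r scalerBl.
      by apply: addmx_sub; rewrite ?eqmx_opp.
    by rewrite (eqmx_scale z (_ : s - t != 0)) // subr_eq0.
  have yK : (y <= K)%MS.
    rewrite -[y](addrK (s *: z)); apply: addmx_sub; rewrite ?eqmx_opp //.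
    exact: scalemx_sub.
  move: KH; rewrite inE => /predU1P[KH|/yH]; last by rewrite yK.
  by rewrite KH (negPf zH) in zK.
exists (y + t *: z); first by rewrite addmx_sub // scalemx_sub.
by move=> K /tP /negP.
Qed.

End Avoidance.

Section Representation.
Variables (R : realType) (d n : nat) (G : sgraph n) (B : 'M[R]_d).
Hypotheses (Bsym : B^T = B) (Bunit : B \in unitmx).

Definition bil (x y : 'rV[R]_d) : R := (x *m B *m y^T) 0 0.

Lemma bilC x y : bil x y = bil y x.
Proof.
rewrite /bil -[in LHS](trmxK (x *m B *m y^T)) mxE.
by rewrite !trmx_mul trmxK Bsym mulmxA.
Qed.

(** The second clause is what makes representations extensible: it ensures that
    the hyperplanes orthogonal to two of the vectors are distinct. *)
Definition orth_rep (S : {set 'I_n}) (x : 'I_n -> 'rV[R]_d) : Prop :=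
  (forall i j, i \in S -> j \in S -> i != j -> (bil (x i) (x j) == 0) = G i j) /\
  (forall i j, i \in S -> j \in S -> i != j -> ~~ (x i <= x j)%MS).

Definition perp (x : 'rV[R]_d) : 'M[R]_d := kermx (B *m x^T).

Lemma sub_perp x y : (y <= perp x)%MS = (bil y x == 0).
Proof.
apply/sub_kermxP/eqP => [|yx]; first by rewrite mulmxA /bil => ->; rewrite mxE.
by apply/rowP => i; rewrite ord1 mulmxA [LHS]yx mxE.
Qed.

Lemma perp_independent (x y : 'rV[R]_d) :
  x != 0 -> ~~ (y <= x)%MS -> ~~ (perp x <= perp y)%MS.
Proof.
move=> x0 yx; have free : row_free (col_mx x y).
  apply: row_free_ker => v; rewrite -[v]hsubmxK mul_row_col.
  rewrite [lsubmx v]mx11_scalar [rsubmx v]mx11_scalar !mul_scalar_mx.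
  set a := lsubmx v 0 0; set b := rsubmx v 0 0 => ab.
  have b0 : b = 0.
    apply: contraNeq yx => b0; rewrite -(eqmx_scale _ b0).
    by move/eqP: ab; rewrite addrC addr_eq0 => /eqP ->; rewrite eqmx_opp scalemx_sub.
  move: ab; rewrite b0 scale0r addr0 => /eqP; rewrite scaler_eq0 (negPf x0) orbF => /eqP ->.
  by rewrite !raddf0 row_mx0.
(* A vector orthogonal to x but not to y, dual to the free family x, y. *)
pose z := (invmx B *m (pinvmx (col_mx x y) *m delta_mx (rshift 1 0) 0))^T : 'rV[R]_d.
have zE : col_mx x y *m (B *m z^T) = delta_mx (rshift 1 0) 0.
  by rewrite trmxK mulKVmx // mulmxA mulmxVp // mul1mx.
rewrite mul_col_mx in zE.
have zx : bil z x = 0.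
  rewrite bilC /bil -mulmxA; have := congr1 (fun M => usubmx M 0 0) zE.
  by rewrite col_mxKu => ->; rewrite !mxE.
have zy : bil z y != 0.
  rewrite bilC /bil -mulmxA; have := congr1 (fun M => dsubmx M 0 0) zE.
  by rewrite col_mxKd => ->; rewrite !mxE !eqxx oner_eq0.
apply: contra zy => xy; rewrite -sub_perp; apply: submx_trans xy.
by rewrite sub_perp zx.
Qed.

Lemma rank_perp x : (d <= \rank (perp x) + 1)%N.
Proof.
rewrite mxrank_ker; have := rank_leq_col (B *m x^T); lia.
Qed.

(** The new vector is generic in the hyperplane orthogonal to the only neighbour
    of w (or in the whole space): it has to avoid its intersections with the other
    orthogonal hyperplanes and, for it not to be parallel to another vector, lines,
    all proper subspaces since the hyperplane has dimension at least 2. *)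
Lemma orth_rep_add (S : {set 'I_n}) x w : (2 < d)%N -> (1 < #|S|)%N ->
    w \notin S -> few_nbrs G S w -> orth_rep S x ->
  exists y, orth_rep (w |: S) (fun i => if i == w then y else x i).
Proof.
move=> d3 S2 wS few [xG xpar].
have xn0 i : i \in S -> x i != 0.
  move=> iS; have [j jS ji] : exists2 j, j \in S & j != i.
    apply: contrapT => noj; move: S2; rewrite ltnNge -(cards1 i) subset_leq_card //.
    apply/fintype.subsetP => j jS; rewrite inE; apply: contrapT => /negP ji.
    by apply: noj; exists j.
  by apply: contraNneq (xpar i j iS jS (contra_neq (@esym _ _ _) ji)) => ->; rewrite sub0mx.
pose Hs (T : {set 'I_n}) := [seq perp (x i) | i in T] ++ [seq <<x i>>%MS | i in S].
have good (L : 'M[R]_d) (T : {set 'I_n}) : (1 < \rank L)%N -> T \subset S ->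
    (forall i, i \in T -> ~~ (L <= perp (x i))%MS) ->
    exists2 y, (y <= L)%MS & (forall i, i \in T -> bil y (x i) != 0) /\
       forall i, i \in S -> ~~ (y <= x i)%MS /\ ~~ (x i <= y)%MS.
  move=> L2 TS LT; have [|y yL yH] := @avoid_subspaces R d L (Hs T).
    move=> H; rewrite mem_cat => /orP[/imageP[i iT ->]|/imageP[i iS ->]]; first exact: LT.
    rewrite genmxE; apply: contraL L2 => /mxrankS; rewrite -leqNgt => /leq_trans; apply.
    exact: rank_leq_row.
  exists y => //; split=> i iS.
    rewrite -sub_perp; apply: yH; rewrite mem_cat; apply/orP; left.
    by apply/imageP; exists i.
  have yi : ~~ (y <= x i)%MS.
    have := yH <<x i>>%MS; rewrite genmxE; apply; rewrite mem_cat; apply/orP; right.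
    by apply/imageP; exists i.
  split=> //; apply: contra yi => /sub_rVP[a xa]; rewrite xa eqmx_scale //.
  by apply: contraNneq (xn0 i iS) => a0; rewrite xa a0 scale0r.
suff [y [yG ypar]] : exists y, (forall i, i \in S -> (bil y (x i) == 0) = G w i) /\
       forall i, i \in S -> ~~ (y <= x i)%MS /\ ~~ (x i <= y)%MS.
  exists y; split=> i j; rewrite !in_setU1.
    have [->|iw] := eqVneq i w; have [->|jw] := eqVneq j w => //=; rewrite ?eqxx //.
    - by move=> _ jS _; exact: yG.
    - by move=> iS _ _; rewrite bilC yG // adj_sym.
    - exact: xG.
  have [->|iw] := eqVneq i w; have [->|jw] := eqVneq j w => //=; rewrite ?eqxx //.
  - by move=> _ /ypar[].
  - by move=> /ypar[].
  - exact: xpar.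
have [[u uS wu]|nou] := pselect (exists2 u, u \in S & G w u).
  have [||i|y yL [yT yS]] := @good (perp (x u)) (S :\ u).
  - have := rank_perp (x u); lia.
  - exact: subsetDl.
  - by move=> /setD1P[iu iS]; apply: perp_independent; rewrite ?xn0 // xpar.
  exists y; split=> // i iS; have [->|iu] := eqVneq i u; first by rewrite wu -sub_perp.
  rewrite (negPf (yT i _)) ?in_setD1 ?iu //; apply/esym/negP => wi.
  by rewrite (few i u) ?eqxx in iu.
have [||i iS|y _ [yT yS]] := @good 1%:M S.
- by rewrite mxrank1; lia.
- exact: subxx.
- apply: contra (xn0 i iS) => /sub_kermxP; rewrite mul1mx => Bx.
  by rewrite -trmx_eq0 -(mulKmx Bunit (x i)^T) Bx mulmx0.
exists y; split=> // i iS; rewrite (negPf (yT i iS)); apply/esym/negP => wi.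
by apply: nou; exists i.
Qed.

Lemma orth_rep_grows (S : {set 'I_n}) x : (2 < d)%N -> (1 < #|S|)%N -> grows G S ->
  orth_rep S x -> exists2 x', orth_rep setT x' & forall i, i \in S -> x' i = x i.
Proof.
move=> d3 S2 gS; elim: gS x S2 => [{}S -> x _ xS|{}S w wS few _ IH x S2 xS].
  by exists x.
have [y yS] := orth_rep_add d3 S2 wS few xS.
have [|x' x'T x'E] := IH _ _ yS; first by rewrite cardsU1 wS; lia.
exists x' => // i iS; rewrite x'E ?in_setU1 ?iS ?orbT //.
by case: eqP iS => // ->; rewrite (negPf wS).
Qed.

Definition gram (x : 'I_n -> 'rV[R]_d) : 'M[R]_n :=
  (\matrix_i x i) *m B *m (\matrix_i x i)^T.

Lemma gramE x i j : gram x i j = bil (x i) (x j).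
Proof.
rewrite /gram /bil mxE [RHS]mxE; apply: eq_bigr => k _; rewrite !mxE.
by congr (_ * _); apply: eq_bigr => l _; rewrite !mxE.
Qed.

Lemma gram_S_graph x : orth_rep setT x -> S_graph (compl_graph G) (gram x).
Proof.
move=> [xG _]; split.
  by apply/matrixP => i j; rewrite mxE !gramE bilC.
by move=> i j ij; rewrite gramE xG ?inE //= /compl_rel ij.
Qed.

(** The Gram matrix of vectors of dimension [d] has rank at most [d]. *)
Lemma q_compl_le_rep x : orth_rep setT x -> (q_graph R (compl_graph G) <= d + 1)%N.
Proof.
move=> /gram_S_graph/q_graph_le /leq_trans; apply.
apply: leq_trans (q_mx_le_rank _) _; rewrite leq_add2r.
by apply: leq_trans (mxrankM_maxr _ _) (rank_leq_row _).
Qed.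

End Representation.

(** * Weights that create a double eigenvalue *)

Section SmallParameter.
Variable R : realType.

Lemma poly_bounded (p : {poly R}) : exists M, forall e, 0 <= e <= 1 -> `|p.[e]| <= M.
Proof.
elim/poly_ind: p => [|p c [M pM]]; first by exists 0 => e _; rewrite horner0 normr0.
exists (M + `|c|) => e e01; rewrite hornerMXaddC (le_trans (ler_normD _ _)) // lerD2r.
have /andP[e0 e1] := e01; rewrite normrM (ger0_norm e0) (le_trans _ (pM e e01)) //.
by rewrite ler_piMr.
Qed.

(** Continuity of polynomials at 0, for finitely many at once. *)
Lemma polys_positive_near0 (ps : seq {poly R}) : (forall p, p \in ps -> 0 < p.[0]) ->
  exists2 e, 0 < e & forall p, p \in ps -> 0 < p.[e].
Proof.
move=> ps0; suff [d d0 dP] : exists2 d, 0 < d & forall e p, 0 < e < d -> p \in ps -> 0 < p.[e].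
  exists (d / 2); first by rewrite divr_gt0.
  by move=> p; apply: dP; lra.
elim: ps ps0 => [|p ps IH] ps0; first by exists 1.
have [|d d0 dP] := IH; first by move=> q qps; apply: ps0; rewrite inE qps orbT.
have {ps0} := ps0 p (mem_head _ _); elim/poly_ind: p => [|q c _]; first by rewrite horner0 ltxx.
rewrite hornerMXaddC mulr0 add0r => c0; have [M qM] := poly_bounded q.
have M0 : 0 <= M by apply: le_trans (normr_ge0 _) (qM 0 _); rewrite lexx ler01.
have M1 : 0 < M + 1 by rewrite ltr_wpDl.
exists (Num.min d (Num.min 1 (c / (M + 1)))).
  by rewrite !lt_min d0 ltr01 divr_gt0.
move=> e p /andP[e0]; rewrite !lt_min => /and3P[ed e1 ec].
rewrite inE => /predU1P[->|/dP]; last by apply; rewrite e0.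
rewrite hornerMXaddC; have := qM e; rewrite (ltW e0) (ltW e1) => /(_ isT).
rewrite ler_norml => /andP[qe _]; rewrite ltr_pdivlMr // in ec.
have : - M * e <= q.[e] * e by rewrite ler_pM2r.
lra.
Qed.

End SmallParameter.

Section Triple.
Variables (R : realType) (d n : nat) (G : sgraph n).
Local Notation rep := (orth_rep G (1%:M : 'M[R]_d) setT).

Lemma bil1_ge0 (v : 'rV[R]_d) : 0 <= bil 1%:M v v.
Proof.
rewrite /bil mulmx1 mxE; apply: sumr_ge0 => i _; rewrite mxE -expr2; exact: sqr_ge0.
Qed.

Lemma bil1_gt0 (v : 'rV[R]_d) : v != 0 -> 0 < bil 1%:M v v.
Proof.
move=> v0; rewrite lt_neqAle bil1_ge0 andbT eq_sym; apply: contra v0.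
rewrite /bil mulmx1 mxE psumr_eq0 => [/allP vv|i _]; last by rewrite mxE -expr2; exact: sqr_ge0.
apply/eqP/rowP => i; have := vv i (mem_index_enum i).
by rewrite mxE mulf_eq0 orbb mxE => /eqP.
Qed.

Lemma orth_rep_scale (x : 'I_n -> 'rV[R]_d) (r : 'I_n -> R) : (forall i, r i != 0) ->
  rep x -> rep (fun i => r i *: x i).
Proof.
move=> r0 [xG xpar]; split=> i j iS jS ij.
  rewrite -(xG i j iS jS ij) /bil -!scalemxAl linearZ /= -scalemxAr !mxE.
  by rewrite !mulf_eq0 !(negPf (r0 _)).
by rewrite !eqmx_scale // xpar.
Qed.

(** With Y the matrix of the vectors, Y Y^T belongs to S(G^c) and shares its
    nonzero eigenvalues and their multiplicities with Y^T Y. The hypotheses say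
    that 1 is at least a double eigenvalue of Y^T Y, so that at most [d] eigenvalues
    are left, counting 0. *)
Lemma q_compl_le_two_fixed (y : 'I_n -> 'rV[R]_d) (k1 k2 : 'rV[R]_d) :
    rep y -> row_free (col_mx k1 k2) ->
    (\sum_j bil 1%:M k1 (y j) *: y j = k1) -> (\sum_j bil 1%:M k2 (y j) *: y j = k2) ->
  (q_graph R (compl_graph G) <= d)%N.
Proof.
move=> yrep kfree k1E k2E; pose Y := \matrix_i y i.
have frameE k : k *m (Y^T *m Y) = \sum_j bil 1%:M k (y j) *: y j.
  rewrite mulmxA mulmx_sum_row; apply: eq_bigr => j _; rewrite rowK; congr (_ *: _).
  by rewrite /bil mulmx1 !mxE; apply: eq_bigr => i _; rewrite !mxE.
pose K := col_mx k1 k2; have KW : K *m (Y^T *m Y) = K.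
  by rewrite mul_col_mx !frameE k1E k2E.
have M1 := gram_S_graph (trmx1 _ _) yrep; set M := gram _ _ in M1.
have ME : M = Y *m Y^T by rewrite /M /gram mulmx1.
have KYfree : row_free (K *m Y^T).
  apply: row_free_ker => v vK0; suff : v *m K = 0 by move/eqP; rewrite mulmx_free_eq0 // => /eqP.
  by rewrite -KW !mulmxA -[v *m K *m _]mulmxA vK0 mul0mx.
have KYM : K *m Y^T *m (M - 1%:M) = 0.
  by rewrite mulmxBr mulmx1 ME mulmxA -[K *m _ *m Y]mulmxA KW subrr.
have r1 := rank_mul0_le KYfree KYM.
have r0 : (\rank M <= d)%N.
  by rewrite ME; apply: leq_trans (mxrankM_maxl _ _) (rank_leq_col _).
have /(q_mx_le_rank2 M) : (0 : R) != 1 by rewrite eq_sym oner_eq0.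
have -> : M - 0%:M = M by rewrite raddf0 subr0.
move: (q_graph_le M1) r0 r1.
move: (\rank _) (\rank _) (q_mx _) (q_graph _ _) => p q q' q''; clear; lia.
Qed.

(** The symmetric 3 by 3 matrix of rank one with off-diagonal entries g has
    diagonal entries g a b * g a c / g b c, and so on; the inequalities say that the
    diagonal of g exceeds them. *)
Definition triple_cond (g : 'I_n -> 'I_n -> R) (a b c : 'I_n) : Prop :=
  [/\ g a b != 0, g a c != 0 & g b c != 0] /\
  [/\ g a b * g a c * g b c < g a a * g b c ^+ 2,
      g a b * g a c * g b c < g b b * g a c ^+ 2 &
      g a b * g a c * g b c < g c c * g a b ^+ 2].

Definition rest_op (x : 'I_n -> 'rV[R]_d) (a b c : 'I_n) (s : 'I_n -> R) : 'M[R]_d :=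
  \sum_(j | j \notin [:: a; b; c]) s j *: ((x j)^T *m x j).

Lemma rest_op_mul x a b c s k :
  k *m rest_op x a b c s = \sum_(j | j \notin [:: a; b; c]) (s j * bil 1%:M k (x j)) *: x j.
Proof.
rewrite mulmx_sumr; apply: eq_bigr => j _; rewrite -scalemxAr mulmxA -scalerA; congr (_ *: _).
by rewrite [k *m _]mx11_scalar mul_scalar_mx /bil mulmx1.
Qed.

Lemma rest_op_sym x a b c s : (rest_op x a b c s)^T = rest_op x a b c s.
Proof.
rewrite /rest_op raddf_sum /=; apply: eq_bigr => j _.
by rewrite linearZ /= trmx_mul trmxK.
Qed.

(** Let the weights of a, b, c be the inverses of the three positive differences
    in [triple_cond]. For a combination u of x_a, x_b, x_c, the vector k = u T is
    fixed by the whole weighted sum if the coefficients of u lie in the kernel of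
    the matrix g minus the diagonal of inverse weights. That matrix has rank one by
    the choice of the weights, which leaves two independent vectors k. *)
Lemma q_compl_le_weighted x a b c (s : 'I_n -> R) (T : 'M[R]_d) :
    rep x -> uniq [:: a; b; c] -> (forall j, 0 < s j) ->
    T^T = T -> T *m (1%:M - rest_op x a b c s) = 1%:M ->
    triple_cond (fun i j => bil T (x i) (x j)) a b c ->
  (q_graph R (compl_graph G) <= d)%N.
Proof.
move=> xrep uabc s0 Tsym TQ [[]].
set g := fun i j => bil T (x i) (x j).
have gC i j : g i j = g j i by rewrite /g bilC.
rewrite -![bil T (x _) (x _)]/(g _ _) => ab0 ac0 bc0 [wa wb wc].
have wa' : 0 < g a a - g a b * g a c / g b c.
  have -> : g a a - g a b * g a c / g b c = (g a a * g b c ^+ 2 - g a b * g a c * g b c) / g b c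
      ^+ 2.
    by field.
  by rewrite divr_gt0 ?subr_gt0 // exprn_even_gt0.
have wb' : 0 < g b b - g a b * g b c / g a c.
  have -> : g b b - g a b * g b c / g a c = (g b b * g a c ^+ 2 - g a b * g a c * g b c) / g a c
      ^+ 2.
    by field.
  by rewrite divr_gt0 ?subr_gt0 // exprn_even_gt0.
have wc' : 0 < g c c - g a c * g b c / g a b.
  have -> : g c c - g a c * g b c / g a b = (g c c * g a b ^+ 2 - g a b * g a c * g b c) / g a b
      ^+ 2.
    by field.
  by rewrite divr_gt0 ?subr_gt0 // exprn_even_gt0.
move: uabc; rewrite /= !inE !negb_or andbT => /andP[/andP[ab ac] bc].
pose w j := if j == a then (g a a - g a b * g a c / g b c)^-1 else
            if j == b then (g b b - g a b * g b c / g a c)^-1 else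
            if j == c then (g c c - g a c * g b c / g a b)^-1 else s j.
have w0 j : 0 < w j by rewrite /w; do !case: eqP => _; rewrite ?invr_gt0.
pose r j := Num.sqrt (w j).
have r0 j : r j != 0 by rewrite sqrtr_eq0 -ltNge.
have frameE k : \sum_j bil 1%:M k (r j *: x j) *: (r j *: x j) =
    k *m rest_op x a b c s + (w a * bil 1%:M k (x a)) *: x a
    + (w b * bil 1%:M k (x b)) *: x b + (w c * bil 1%:M k (x c)) *: x c.
  have -> : \sum_j bil 1%:M k (r j *: x j) *: (r j *: x j) =
            \sum_j (w j * bil 1%:M k (x j)) *: x j.
    apply: eq_bigr => j _; rewrite scalerA; congr (_ *: _).
    rewrite /bil linearZ /= -scalemxAr mxE mulrAC -expr2 sqr_sqrtr ?ltW //.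
  rewrite (bigD1 a) //= (bigD1 b) 1?eq_sym //= (bigD1 c) /=;
      last by rewrite ![c == _]eq_sym ac bc.
  set rest := \sum_(j | _) _; have -> : k *m rest_op x a b c s = rest.
    rewrite rest_op_mul; apply: eq_big => j; rewrite !inE !negb_or ?andbA //.
    by rewrite /w => /andP[/andP[/negPf -> /negPf ->] /negPf ->].
  by rewrite !addrA [LHS]addrC !addrA.
have kQ k : k *m T *m rest_op x a b c s = k *m T - k.
  have := congr1 (mulmx k) TQ; rewrite mulmxA mulmxBr !mulmx1 => e.
  by rewrite -{3}e subKr.
(* Two coefficient rows orthogonal to (g a b * g a c, g a b * g b c, g a c * g b c). *)
pose k1 := (g b c *: x a - g a c *: x b) *m T.
pose k2 := (g a c *: x b - g a b *: x c) *m T.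
have bilT u j : bil 1%:M (u *m T) (x j) = bil T u (x j) by rewrite /bil mulmx1.
have bil_lin (p q : R) u v j : bil T (p *: u - q *: v) (x j) =
    p * bil T u (x j) - q * bil T v (x j).
  by rewrite /bil !mulmxBl -!scalemxAl !mxE.
have k1a : bil 1%:M k1 (x a) = g b c * (g a a - g a b * g a c / g b c).
  by rewrite bilT bil_lin -!/(g _ _) (gC b a); field.
have k1b : bil 1%:M k1 (x b) = - g a c * (g b b - g a b * g b c / g a c).
  by rewrite bilT bil_lin -!/(g _ _); field.
have k1c : bil 1%:M k1 (x c) = 0 by rewrite bilT bil_lin -!/(g _ _); ring.
have k2a : bil 1%:M k2 (x a) = 0.
  by rewrite bilT bil_lin -!/(g _ _) (gC b a) (gC c a); ring.
have k2b : bil 1%:M k2 (x b) = g a c * (g b b - g a b * g b c / g a c).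
  by rewrite bilT bil_lin -!/(g _ _) (gC c b); field.
have k2c : bil 1%:M k2 (x c) = - g a b * (g c c - g a c * g b c / g a b).
  by rewrite bilT bil_lin -!/(g _ _); field.
have waE : w a = (g a a - g a b * g a c / g b c)^-1 by rewrite /w eqxx.
have wbE : w b = (g b b - g a b * g b c / g a c)^-1 by rewrite /w eq_sym (negPf ab) eqxx.
have wcE : w c = (g c c - g a c * g b c / g a b)^-1.
  by rewrite /w ![c == _]eq_sym (negPf ac) (negPf bc) eqxx.
apply: (@q_compl_le_two_fixed (fun j => r j *: x j) k1 k2).
- exact: orth_rep_scale.
- apply: row_free_ker => v; rewrite -[v]hsubmxK mul_row_col.
  rewrite [lsubmx v]mx11_scalar [rsubmx v]mx11_scalar !mul_scalar_mx.
  set p := lsubmx v 0 0; set q := rsubmx v 0 0 => pq0.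
  have dot j : p * bil 1%:M k1 (x j) + q * bil 1%:M k2 (x j) = 0.
    have := congr1 (fun u => bil 1%:M u (x j)) pq0; rewrite /bil !mulmx1 mul0mx mulmxDl.
    by rewrite -!scalemxAl !mxE.
  have := dot a; rewrite k1a k2a mulr0 addr0 => /eqP.
  rewrite !mulf_eq0 (negPf bc0) (gt_eqF wa') !orbF => /eqP ->.
  have := dot c; rewrite k1c k2c mulr0 add0r => /eqP.
  rewrite !mulf_eq0 oppr_eq0 (negPf ab0) (gt_eqF wc') !orbF => /eqP ->.
  by rewrite !raddf0 row_mx0.
- rewrite frameE kQ k1a k1b k1c waE wbE mulr0 scale0r addr0.
  rewrite mulrCA mulVf ?gt_eqF // mulr1 mulrCA mulVf ?gt_eqF // mulr1 scaleNr -addrA.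
  exact: subrK.
rewrite frameE kQ k2a k2b k2c wbE wcE mulr0 scale0r addr0.
rewrite mulrCA mulVf ?gt_eqF // mulr1 mulrCA mulVf ?gt_eqF // mulr1 scaleNr -addrA.
exact: subrK.
Qed.

Lemma horner_map_polyC p q (A : 'M[R]_(p, q)) e :
  map_mx (horner_eval e) (map_mx polyC A) = A.
Proof. by apply/matrixP => i j; rewrite !mxE /horner_eval hornerC. Qed.

Lemma horner_map_affine (A B : 'M[R]_d) e :
  map_mx (horner_eval e) (map_mx polyC A - 'X *: map_mx polyC B) = A - e *: B.
Proof.
by apply/matrixP => i j; rewrite !mxE /horner_eval hornerD hornerN hornerM hornerX !hornerC.
Qed.

(** Weights may vanish in the hypothesis: adding a small e to all of them
    preserves the inequalities. With the inverse matrix written as adjugate over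
    determinant, they become positivity of polynomials in e. *)
Lemma q_compl_le_triple x a b c (t : 'I_n -> R) (T : 'M[R]_d) :
    rep x -> uniq [:: a; b; c] -> (forall j, 0 <= t j) ->
    T *m (1%:M - rest_op x a b c t) = 1%:M ->
    triple_cond (fun i j => bil T (x i) (x j)) a b c ->
  (q_graph R (compl_graph G) <= d)%N.
Proof.
move=> xrep uabc t0 TQ0; set Q0 := 1%:M - _ in TQ0 => gcond.
have [Tu Q0u] := mulmx1_unit TQ0.
pose N0 := rest_op x a b c (fun=> 1).
pose Qp : 'M[{poly R}]_d := map_mx polyC Q0 - 'X *: map_mx polyC N0.
pose Q e := 1%:M - rest_op x a b c (fun j => t j + e).
have Qe e : Q e = Q0 - e *: N0.
  rewrite /Q /Q0 -addrA -opprD; congr (_ - _).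
  rewrite /rest_op /N0 /rest_op scaler_sumr -big_split /=; apply: eq_bigr => j _.
  by rewrite scale1r scalerDl.
have QpE e : map_mx (horner_eval e) Qp = Q e by rewrite horner_map_affine Qe.
pose D := \det Qp; have DE e : D.[e] = \det (Q e).
  by rewrite -QpE -[LHS]/(horner_eval e D) /D -det_map_mx.
pose h i j : {poly R} := (map_mx polyC (x i) *m \adj Qp *m (map_mx polyC (x j))^T) 0 0.
have hE e i j : (h i j).[e] = bil (\adj (Q e)) (x i) (x j).
  have -> : (h i j).[e] = (map_mx (horner_eval e)
      (map_mx polyC (x i) *m \adj Qp *m (map_mx polyC (x j))^T)) 0 0 by rewrite [RHS]mxE.
  by rewrite !map_mxM map_mx_adj map_trmx !horner_map_polyC QpE.
have Q00 : Q 0 = Q0 by rewrite Qe scale0r subr0.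
have gE e i j : \det (Q e) != 0 ->
    bil (invmx (Q e)) (x i) (x j) = (h i j).[e] / D.[e].
  move=> dQ; rewrite hE DE /bil /invmx unitmxE unitfE dQ.
  by rewrite -scalemxAr -scalemxAl mxE mulrC.
have D0 : D.[0] != 0 by rewrite DE Q00 -unitfE -unitmxE.
have TE : T = invmx (Q 0) by rewrite Q00 -(mulmxK Q0u T) TQ0 mul1mx.
pose F (p q r : 'I_n) := D * (h p p * h q r ^+ 2 - h a b * h a c * h b c).
have Fsign e p q r : D.[e] != 0 -> (0 < (F p q r).[e]) =
      ((h a b).[e] / D.[e] * ((h a c).[e] / D.[e]) * ((h b c).[e] / D.[e]) <
       (h p p).[e] / D.[e] * ((h q r).[e] / D.[e]) ^+ 2).
  move=> De; rewrite -[RHS]subr_gt0 -[RHS](pmulr_rgt0 _ (_ : 0 < D.[e] ^+ 4)); last first.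
    by rewrite exprn_even_gt0.
  by rewrite (_ : D.[e] ^+ 4 * _ = (F p q r).[e]) // /F !(hornerM, hornerD, hornerN,
      horner_exp); field.
have [|e e0 pos] := @polys_positive_near0 R
  [:: D ^+ 2; h a b ^+ 2; h a c ^+ 2; h b c ^+ 2; F a b c; F b a c; F c a b].
  have DQ0 : \det (Q 0) != 0 by rewrite -DE.
  move: gcond; rewrite TE /triple_cond !gE // !mulf_eq0 !invr_eq0 !(negPf D0) !orbF.
  case=> [[ab0 ac0 bc0] [Fa Fb Fc]].
  have sq (p : {poly R}) : p.[0] != 0 -> 0 < (p ^+ 2).[0].
    by move=> p0; rewrite horner_exp exprn_even_gt0.
  rewrite -!(Fsign 0) // in Fa Fb Fc.
  by move=> p; rewrite !inE => /or4P[/eqP ->|/eqP ->|/eqP ->|/or4P[/eqP ->|/eqP ->|/eqP ->|/eqP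
      ->]];
    do ?[exact: sq|done].
have sq (p : {poly R}) : 0 < (p ^+ 2).[e] -> p.[e] != 0.
  by apply: contraTneq => p0; rewrite horner_exp p0 expr0n ltxx.
have De0 : D.[e] != 0 by apply/sq/pos; rewrite !inE eqxx.
have De : \det (Q e) != 0 by rewrite -DE.
apply: (@q_compl_le_weighted x a b c (fun j => t j + e) (invmx (Q e))) => //.
- by move=> j; rewrite ltr_wpDl.
- by rewrite trmx_inv /Q linearB /= trmx1 rest_op_sym.
- by rewrite mulVmx // unitmxE unitfE.
rewrite /triple_cond !gE // !mulf_eq0 !invr_eq0 !(negPf De0) !orbF.
rewrite -!(Fsign e) //; split; split; do ?apply: sq; by apply: pos; rewrite !inE eqxx ?orbT.
Qed.

End Triple.

(** * Explicit representations *)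

Section BaseReps.
Variables (R : realType) (n : nat) (G : sgraph n).

Lemma minor_not_sub d (x y : 'rV[R]_d) k l :
  x 0 k * y 0 l != x 0 l * y 0 k -> ~~ (x <= y)%MS.
Proof.
apply: contra => /sub_rVP[a ->]; rewrite !mxE; apply/eqP; ring.
Qed.

(** The form for which the product of (1, s, s^2) and (1, t, t^2) is
    (s - t)^2 - 1, so that the points 0, 1, 2, ... of the parabola represent a
    path. *)
Definition parabola_form : 'M[R]_3 :=
  \matrix_(i, j) nth 0 (nth [::] [:: [:: -1; 0; 1]; [:: 0; -2; 0]; [:: 1; 0; 0]] i) j.

Definition vec3 (a b c : R) : 'rV[R]_3 := \row_i nth 0 [:: a; b; c] i.

Lemma bil_parabola a b c a' b' c' :
  bil parabola_form (vec3 a b c) (vec3 a' b' c') = a * c' + c * a' - a * a' - 2 * (b * b').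
Proof.
rewrite /bil mxE !big_ord_recl big_ord0 !mxE !big_ord_recl !big_ord0 !mxE /=; ring.
Qed.

Lemma parabola_form_sym : parabola_form^T = parabola_form.
Proof.
by apply/matrixP => -[[|[|[|//]]] i] [[|[|[|//]]] j]; rewrite !mxE.
Qed.

Lemma parabola_form_unit : parabola_form \in unitmx.
Proof.
pose B' : 'M[R]_3 := \matrix_(i, j)
  nth 0 (nth [::] [:: [:: 0; 0; 1]; [:: 0; - 2^-1; 0]; [:: 1; 0; 1]] i) j.
suff /mulmx1_unit[] : parabola_form *m B' = 1%:M by [].
apply/matrixP => -[[|[|[|//]]] i] [[|[|[|//]]] j];
  rewrite !mxE !big_ord_recl big_ord0 !mxE /=; lra.
Qed.

(** The first k - 1 vertices are put on the parabola. The last vector must be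
    orthogonal to the points 0 and k - 2 only; its product with (1, t, t^2) is
    t (t - (k - 2)). It is parallel to a point of the parabola only for k = 4. *)
Lemma q_compl_long_cycle c : sole_cycle G c -> (4 < size c)%N ->
  (q_graph R (compl_graph G) <= 4)%N.
Proof.
move=> c_sole k5; pose k := size c.
have [_ /andP[_ uc] _] := c_sole.
pose f (p : nat) : 'rV[R]_3 :=
  if p.+1 == k then vec3 1 ((k%:R - 2) / 2) 1 else vec3 1 p%:R (p%:R ^+ 2).
pose x i := f (index i c).
have fE p q : (p < q < k)%N -> (bil parabola_form (f p) (f q) == 0) = cyc_adj k p q.
  move=> /andP[pq qk]; rewrite /f (_ : (p.+1 == k) = false); last by lia.
  case: (q.+1 =P k) => qk1; rewrite bil_parabola.
    have -> : 1 * 1 + p%:R ^+ 2 * 1 - 1 * 1 - 2 * (p%:R * ((k%:R - 2) / 2)) =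
       p%:R * (p.+2%:R - k%:R) :> R by rewrite -(natr1 p.+1) -(natr1 p); field.
    rewrite mulf_eq0 subr_eq0 pnatr_eq0 eqr_nat /cyc_adj; lia.
  have -> : 1 * q%:R ^+ 2 + p%:R ^+ 2 * 1 - 1 * 1 - 2 * (p%:R * q%:R) =
       (p.+1%:R - q%:R) * (p%:R - q.+1%:R) :> R by rewrite -(natr1 p) -(natr1 q); ring.
  rewrite mulf_eq0 !subr_eq0 !eqr_nat /cyc_adj; lia.
have fpar p q : (p < k)%N -> (q < k)%N -> p != q -> ~~ (f p <= f q)%MS.
  move=> pk qk pq; apply/negP => /sub_rVP[s /rowP fpq].
  have := fpq 0; have := fpq 1; have := fpq (inord 2).
  rewrite /f; case: (p.+1 =P k) => pk1; case: (q.+1 =P k) => qk1; rewrite !mxE ?inordK //=;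
      try lia.
  - move=> e2 e1 e0; have s1 : s = 1 by lra.
    move: e2 e1; rewrite s1 !mul1r => /esym/eqP.
    rewrite sqrf_eq1 => /orP[/eqP q1|/eqP qN]; last first.
      by have := ler0n R q; rewrite qN; lra.
    rewrite q1 => e1; have : k%:R = 4%:R :> R by lra.
    by move/eqP; rewrite eqr_nat => /eqP k4; move: k5; rewrite -/k k4.
  - move=> e2 e1 e0; have s1 : s = 1 by lra.
    move: e2 e1; rewrite s1 !mul1r => /eqP.
    rewrite sqrf_eq1 => /orP[/eqP q1|/eqP qN]; last first.
      by have := ler0n R p; rewrite qN; lra.
    rewrite q1 => e1; have : k%:R = 4%:R :> R by lra.
    by move/eqP; rewrite eqr_nat => /eqP k4; move: k5; rewrite -/k k4.
  move=> _ e1 e0; have s1 : s = 1 by lra.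
  by move: e1; rewrite s1 mul1r => /eqP; rewrite eqr_nat (negPf pq).
have xrep : orth_rep G parabola_form [set i in c] x.
  have idx i : i \in [set i in c] -> (index i c < k)%N by rewrite inE index_mem.
  have idxI i j : i \in [set i in c] -> j \in [set i in c] -> i != j -> index i c != index j c.
    by rewrite !inE => ic jc; apply: contra_neq => /(congr1 (nth i c)); rewrite !nth_index.
  split=> i j ic jc ij; last by apply: fpar; rewrite ?idx ?idxI.
  have [Gij Gji] : cyc_adj k (index i c) (index j c) = G i j /\
                   cyc_adj k (index j c) (index i c) = G i j.
    rewrite !inE in ic jc; split.
      by rewrite -(cycle_chordless c_sole i) ?index_mem // !nth_index.
    by rewrite -(cycle_chordless c_sole i) ?index_mem // !nth_index // adj_sym.
  have := idxI i j ic jc ij; rewrite neq_ltn => /orP[lt|lt].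
    by rewrite fE ?Gij // lt idx.
  by rewrite bilC ?parabola_form_sym // fE ?Gji // lt idx.
have [||y yrep _] := orth_rep_grows parabola_form_sym parabola_form_unit _ _
  (sole_cycle_grows c_sole) xrep; rewrite //.
  by rewrite cardsE (card_uniqP uc) (leq_trans _ k5).
by have := q_compl_le_rep parabola_form_sym yrep.
Qed.

(** Integer coordinates, so that products and parallelism of explicit vectors are
    decided by computation. *)
Definition dotz d (s t : seq int) : int :=
  foldr +%R 0 [seq s`_i * t`_i | i <- iota 0 d].

Definition independentz d (s t : seq int) : bool :=
  has (fun i => has (fun j => s`_i * t`_j != s`_j * t`_i) (iota 0 d)) (iota 0 d).

Definition int_vec d (s : seq int) : 'rV[R]_d := \row_i (s`_i)%:~R.

Lemma bil_int_vec d s t : bil 1%:M (int_vec d s) (int_vec d t) = (dotz d s t)%:~R.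
Proof.
rewrite /bil mulmx1 mxE /dotz foldrE big_map (_ : iota 0 d = index_iota 0 d) ?big_mkord;
    last by rewrite /index_iota subn0.
by rewrite rmorph_sum /=; apply: eq_bigr => i _; rewrite !mxE rmorphM.
Qed.

Lemma int_vec_not_sub d s t : independentz d s t ->
  ~~ (int_vec d s <= int_vec d t)%MS /\ ~~ (int_vec d t <= int_vec d s)%MS.
Proof.
case/hasP => i; rewrite mem_iota add0n /= => id /hasP[j]; rewrite mem_iota add0n /= => jd st.
split; [apply: (@minor_not_sub _ _ _ (Ordinal id) (Ordinal jd))|
        apply: (@minor_not_sub _ _ _ (Ordinal jd) (Ordinal id))];
  rewrite !mxE /= -!intrM eqr_int //.
by rewrite mulrC [X in _ != X]mulrC.
Qed.

Lemma int_orth_rep d (vs : seq 'I_n) (M : seq (seq int)) v0 : uniq vs ->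
    (forall p q, (p < q < size vs)%N ->
       (dotz d (nth [::] M p) (nth [::] M q) == 0) = G (nth v0 vs p) (nth v0 vs q) /\
       independentz d (nth [::] M p) (nth [::] M q)) ->
  orth_rep G 1%:M [set i in vs] (fun i => int_vec d (nth [::] M (index i vs))).
Proof.
move=> uvs MP.
have idx i : i \in [set i in vs] -> (index i vs < size vs)%N by rewrite inE index_mem.
have nidx i : i \in [set i in vs] -> nth v0 vs (index i vs) = i by rewrite inE => /nth_index.
have idxI i j : i \in [set i in vs] -> j \in [set i in vs] -> i != j -> index i vs != index j vs.
  by move=> ic jc; apply: contra_neq => /(congr1 (nth v0 vs)); rewrite !nidx.
split=> i j ic jc ij; have := idxI i j ic jc ij; rewrite neq_ltn => /orP[lt|lt].
- have [|E _] := MP (index i vs) (index j vs); first by rewrite lt idx.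
  by rewrite bil_int_vec intr_eq0 E !nidx.
- have [|E _] := MP (index j vs) (index i vs); first by rewrite lt idx.
  by rewrite bilC ?trmx1 // bil_int_vec intr_eq0 E !nidx // adj_sym.
- have [|_ E] := MP (index i vs) (index j vs); first by rewrite lt idx.
  by have [] := int_vec_not_sub E.
- have [|_ E] := MP (index j vs) (index i vs); first by rewrite lt idx.
  by have [] := int_vec_not_sub E.
Qed.

(** With all other weights 0 the matrix T is the identity, and a negative product
    of the three inner products lies below the positive right-hand sides. *)
Lemma q_compl_le_obtuse d (x : 'I_n -> 'rV[R]_d) a b c :
    orth_rep G 1%:M setT x -> uniq [:: a; b; c] ->
    bil 1%:M (x a) (x b) * bil 1%:M (x a) (x c) * bil 1%:M (x b) (x c) < 0 ->
  (q_graph R (compl_graph G) <= d)%N.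
Proof.
move=> xrep uabc lt0.
have : bil 1%:M (x a) (x b) * bil 1%:M (x a) (x c) * bil 1%:M (x b) (x c) != 0 by rewrite lt_eqF.
rewrite !mulf_eq0 !negb_or => /andP[/andP[ab ac] bc].
have xn0 u v : bil 1%:M u v != 0 -> u != 0 :> 'rV[R]_d.
  by apply: contraNneq => ->; rewrite /bil !mul0mx mxE.
have a0 := bil1_gt0 (xn0 _ _ ab); have b0 := bil1_gt0 (xn0 _ _ bc).
have c0 : 0 < bil 1%:M (x c) (x c).
  by apply/bil1_gt0/(@xn0 _ (x b)); rewrite bilC ?trmx1.
apply: (@q_compl_le_triple R d n G x a b c (fun=> 0) 1%:M) => //.
  by rewrite mul1mx /rest_op big1 ?subr0 // => j _; rewrite scale0r.
split; split=> //; apply: lt_trans lt0 _; rewrite mulr_gt0 // exprn_even_gt0 //.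
Qed.

Lemma q_compl_le_int_obtuse d (vs : seq 'I_n) (M : seq (seq int)) v0 p q r :
    (2 < d)%N -> (1 < size vs)%N -> uniq vs -> grows G [set i in vs] ->
    (forall p q, (p < q < size vs)%N ->
       (dotz d (nth [::] M p) (nth [::] M q) == 0) = G (nth v0 vs p) (nth v0 vs q) /\
       independentz d (nth [::] M p) (nth [::] M q)) ->
    (p < q < r)%N -> (r < size vs)%N ->
    (let g p q := dotz d (nth [::] M p) (nth [::] M q) in g p q * g p r * g q r < 0) ->
  (q_graph R (compl_graph G) <= d)%N.
Proof.
move=> d3 v2 uvs gvs /(int_orth_rep uvs) xrep /andP[pq qr] rv gneg.
have [||y yrep yE] := orth_rep_grows (trmx1 _ _) (unitmx1 _ _) _ _ gvs xrep; rewrite //.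
  by rewrite cardsE (card_uniqP uvs).
have nvs s : (s < size vs)%N -> y (nth v0 vs s) = int_vec d (nth [::] M s).
  by move=> sv; rewrite yE ?inE ?mem_nth // index_uniq.
have qv := ltn_trans qr rv; have pv := ltn_trans pq qv.
apply: (@q_compl_le_obtuse d y (nth v0 vs p) (nth v0 vs q) (nth v0 vs r)) => //.
  by rewrite /= !inE !nth_uniq //; lia.
by rewrite !nvs // !bil_int_vec -!intrM ltrz0.
Qed.

End BaseReps.

(** * Cycles of length four *)

Section ShortCycles.
Variables (R : realType) (n : nat) (G : sgraph n).

(** Two neighbours on the cycle would contradict the existence of a leaf outside
    [c] in [c] plus [w]. *)
Lemma few_nbrs_cycle c w : sole_cycle G c -> w \notin c -> few_nbrs G [set i in c] w.
Proof.
move=> c_sole wc; have [|Sc|w' [w'S w'c few]] := @cycle_leaf_outside n G c c_sole (w |: [set i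
    in c]).
- by move=> u uc; rewrite !inE uc orbT.
- by case/negP: wc; apply: Sc; rewrite setU11.
move: w'S; rewrite !inE (negPf w'c) orbF => /eqP w'w.
by move=> u v uc vc; rewrite -w'w; apply: few; rewrite in_setU1 ?uc ?vc orbT.
Qed.

(** In dimension 3 two opposite vertices of the 4-cycle would have parallel
    vectors, hence dimension 4. The vertices v0, v2 and w are pairwise nonadjacent,
    and the vector of w is chosen to have products of opposite signs with those of
    v0 and v2. *)
Lemma q_compl_four_cycle v0 v1 v2 v3 w :
    uniq [:: v0; v1; v2; v3; w] -> grows G [set i in [:: v0; v1; v2; v3; w]] ->
    [/\ G v0 v1, G v1 v2, G v2 v3 & G v3 v0] -> [/\ ~~ G v0 v2 & ~~ G v1 v3] ->
    [/\ ~~ G w v0, ~~ G w v2 & ~~ G w v3] ->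
  (q_graph R (compl_graph G) <= 4)%N.
Proof.
move=> uvs gvs [G01 G12 G23 G30] [/negPf G02 /negPf G13] [/negPf Gw0 /negPf Gw2 /negPf Gw3].
pose xw : seq int := if G w v1 then [:: 1; 0; -2; 1] else [:: 1; 1; -2; 3].
apply: (@q_compl_le_int_obtuse R n G 4 [:: v0; v1; v2; v3; w] [:: [:: 1; 0; 0; 0]; [:: 0; 1; 0;
    0];
  [:: 1; 0; 1; 0]; [:: 0; 1; 0; 1]; xw] v0 0 2 4) => //; last first.
  by rewrite /xw; case: ifP.
move=> p q /= /andP[pq q5]; rewrite /xw.
case: q q5 pq => [|[|[|[|[|//]]]]] _ //; case: p => [|[|[|[|//]]]] //= _;
  rewrite ?[G _ w]adj_sym ?[G v0 v3]adj_sym ?G01 ?G12 ?G23 ?G30 ?G02 ?G13 ?Gw0 ?Gw2 ?Gw3 //.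
all: by case: ifP.
Qed.

(** The first vertex added to the cycle has at most one neighbour on it; rotate
    the cycle so that this neighbour, if any, comes second. *)
Lemma q_compl_cycle4 c : sole_cycle G c -> size c = 4 ->
  (q_graph R (compl_graph G) <= 4)%N.
Proof.
move=> c_sole c4; have := sole_cycle_grows c_sole => -[cT|w wc few gw].
  have : n = 4.
    rewrite -[LHS]card_ord -cardsT -cT cardsE -c4; apply/card_uniqP.
    by case: c_sole => _ /andP[].
  by move=> n4; apply: leq_trans (q_graph_le_order R _) _; rewrite n4.
have adjE := cycle_chordless c_sole.
move: c_sole c4 wc few gw adjE; case: c => [|v0 [|v1 [|v2 [|v3 [|//]]]]] // c_sole _ wc few gw
    adjE.
have Gij (i j : nat) : (i < 4)%N -> (j < 4)%N ->
    G (nth v0 [:: v0; v1; v2; v3] i) (nth v0 [:: v0; v1; v2; v3] j) = cyc_adj 4 i j.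
  by move=> i4 j4; rewrite adjE.
have [uc] : uniq [:: v0; v1; v2; v3] by case: c_sole => _ /andP[].
have uw : uniq [:: v0; v1; v2; v3; w].
  by rewrite -[_ :: _]/(rcons [:: v0; v1; v2; v3] w) rcons_uniq uc andbT; rewrite inE in wc.
have gw' : grows G [set i in [:: v0; v1; v2; v3; w]].
  by rewrite (_ : [set i in _] = w |: [set i in [:: v0; v1; v2; v3]]) //; apply/setP => i;
     rewrite !inE; case: (i == v0); case: (i == v1); case: (i == v2); case: (i == v3);
         case: (i == w).
have rot5 s : size s = 5 -> s =i [:: v0; v1; v2; v3; w] -> uniq s /\ grows G [set i in s].
  move=> s5 sE; rewrite (eq_uniq _ sE) // uw; split=> //.
  by rewrite (_ : [set i in s] = [set i in [:: v0; v1; v2; v3; w]]) //; apply/setP => i;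
      rewrite !inE sE !inE.
have G01 : G v0 v1 := Gij 0%N 1%N isT isT.
have G12 : G v1 v2 := Gij 1%N 2%N isT isT.
have G23 : G v2 v3 := Gij 2%N 3%N isT isT.
have G30 : G v3 v0 := Gij 3%N 0%N isT isT.
have G02 : ~~ G v0 v2 by rewrite (Gij 0%N 2%N).
have G13 : ~~ G v1 v3 by rewrite (Gij 1%N 3%N).
have G20 : ~~ G v2 v0 by rewrite (Gij 2%N 0%N).
have G31 : ~~ G v3 v1 by rewrite (Gij 3%N 1%N).
have excl u v : u \in [:: v0; v1; v2; v3] -> v \in [:: v0; v1; v2;
    v3] -> u != v -> G w u -> ~~ G w v.
  move=> uc' vc' uv wu; apply: contra uv => wv; apply/eqP; apply: few; rewrite ?inE //.
  by move: uc'; rewrite !inE. by move: vc'; rewrite !inE.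
have := uc; rewrite /= !inE !negb_or !andbT => /andP[/and3P[n01 n02 n03] /andP[/andP[n12 n13]
    n23]].
have [w0|w0] := boolP (G w v0).
  have [||us gs] := rot5 [:: v3; v0; v1; v2; w]; first by [].
    by move=> i; rewrite !inE; case: (i == v0); case: (i == v1); case: (i == v2);
        case: (i == v3); case: (i == w).
  apply: (q_compl_four_cycle us gs); split=> //; apply: (excl v0); rewrite ?inE ?eqxx ?orbT //.
have [w2|w2] := boolP (G w v2).
  have [||us gs] := rot5 [:: v1; v2; v3; v0; w]; first by [].
    by move=> i; rewrite !inE; case: (i == v0); case: (i == v1); case: (i == v2);
        case: (i == v3); case: (i == w).
  apply: (q_compl_four_cycle us gs); split=> //; apply: (excl v2);
      rewrite ?inE ?eqxx ?orbT // eq_sym //.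
have [w3|w3] := boolP (G w v3).
  have [||us gs] := rot5 [:: v2; v3; v0; v1; w]; first by [].
    by move=> i; rewrite !inE; case: (i == v0); case: (i == v1); case: (i == v2);
        case: (i == v3); case: (i == w).
  apply: (q_compl_four_cycle us gs); split=> //; apply: (excl v3);
      rewrite ?inE ?eqxx ?orbT // eq_sym //.
exact: (q_compl_four_cycle uw gw').
Qed.

End ShortCycles.

(** * Triangles *)

Section Triangle.
Variables (R : realType) (n : nat) (G : sgraph n).

(** Here the triple is the orthonormal triangle, and w keeps the weight
    1 / (1 + s) with s the square of its length, so that T is the identity plus
    x_w^T x_w. The products over the triangle become w_a w_b, w_a w_e, w_b w_e off
    the diagonal, where all coordinates of x_w are nonzero because w is far from
    the triangle. *)
Lemma q_compl_triangle_far a b e w :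
    uniq [:: a; b; e] -> grows G [set i in [:: a; b; e]] ->
    [/\ G a b, G a e & G b e] -> w \notin [:: a; b; e] ->
    [/\ ~~ G w a, ~~ G w b & ~~ G w e] ->
  (q_graph R (compl_graph G) <= 3)%N.
Proof.
move=> uvs gvs [Gab Gae Gbe] wvs [Gwa Gwb Gwe].
have [|||x xrep xE] := orth_rep_grows (trmx1 R 3) (unitmx1 R 3) _ _ gvs
   (@int_orth_rep R n G 3 [:: a; b; e] [:: [:: 1; 0; 0]; [:: 0; 1; 0]; [:: 0; 0; 1]] a uvs _).
- by [].
- by rewrite cardsE (card_uniqP uvs).
- move=> p q /= /andP[pq q5].
  by case: q q5 pq => [|[|[|//]]] _ //; case: p => [|[|//]] //= _; rewrite ?Gab ?Gae ?Gbe.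
have [xG _] := xrep.
have dot0 i j : i != j -> (bil 1%:M (x i) (x j) == 0) = G i j by move=> ij; apply: xG;
    rewrite ?inE.
have dotC i j : bil 1%:M (x i) (x j) = bil 1%:M (x j) (x i) by rewrite bilC ?trmx1.
pose s := bil 1%:M (x w) (x w).
have s0 : 0 <= s := bil1_ge0 (x w).
have s1 : 0 < 1 + s by lra.
pose t j : R := if j == w then (1 + s)^-1 else 0.
pose T : 'M[R]_3 := 1%:M + (x w)^T *m x w.
have ww : (x w)^T *m x w *m ((x w)^T *m x w) = s *: ((x w)^T *m x w).
  rewrite mulmxA -[_ *m x w *m _]mulmxA [x w *m _]mx11_scalar.
  by rewrite mul_mx_scalar -scalemxAl /s /bil mulmx1.
have TE i j : bil T (x i) (x j) = bil 1%:M (x i) (x j) + bil 1%:M (x i) (x w) * bil 1%:M (x w)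
    (x j).
  rewrite /bil /T mulmxDr mulmxDl mxE; congr (_ + _); rewrite !mulmx1 !mulmxA.
  by rewrite [in LHS](mx11_scalar (x i *m _)) mul_scalar_mx -scalemxAl mxE.
move: uvs wvs; rewrite /= !inE !negb_or !andbT => /andP[/andP[ab ae] be] /and3P[wa wb we].
apply: (@q_compl_le_triple R 3 n G x a b e t T) => //.
- by rewrite /= !inE !negb_or ab ae be.
- by move=> j; rewrite /t; case: eqP => // _; rewrite invr_ge0 ltW.
- have -> : rest_op x a b e t = (1 + s)^-1 *: ((x w)^T *m x w).
    rewrite /rest_op (bigD1 w) /=; last by rewrite !inE !negb_or wa wb.
    rewrite {1}/t eqxx big1 ?addr0 // => j /andP[_ /negPf jw].
    by rewrite /t jw scale0r.
  rewrite /T mulmxBr mulmx1 mulmxDl mul1mx -scalemxAr ww scalerA -scalerDl.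
  rewrite -{1}[(x w)^T *m x w]scale1r -addrA -scalerBl (_ : 1 - _ = 0) ?scale0r ?addr0 //.
  by field; rewrite gt_eqF.
have [ga gb ge] : [/\ bil 1%:M (x a) (x w) != 0, bil 1%:M (x b) (x w) != 0 & bil 1%:M (x e) (x
    w) != 0].
  by split; rewrite dotC dot0.
have [dab dae dbe] : [/\ bil 1%:M (x a) (x b) = 0, bil 1%:M (x a) (x e) =
    0 & bil 1%:M (x b) (x e) = 0].
  by split; apply/eqP; rewrite dot0.
have pos i : bil 1%:M (x i) (x w) != 0 -> 0 < bil 1%:M (x i) (x i).
  move=> iw; apply: bil1_gt0; apply: contraNneq iw => ->.
  by rewrite /bil !mul0mx mxE.
rewrite /triple_cond !TE ![bil 1%:M (x w) _]dotC dab dae dbe !add0r.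
split; first by rewrite !mulf_neq0.
have [a0 b0 e0] := And3 (pos a ga) (pos b gb) (pos e ge).
have key (p u v y : R) : 0 < p -> v != 0 -> y != 0 ->
    u * v * (u * y) * (v * y) < (p + u * u) * (v * y) ^+ 2.
  move=> p0 v0 y0; rewrite -subr_gt0.
  have -> : (p + u * u) * (v * y) ^+ 2 - u * v * (u * y) * (v * y) = p * (v * y) ^+ 2 by ring.
  by rewrite mulr_gt0 // exprn_even_gt0 //= mulf_neq0.
move: ga gb ge; set ga := bil _ _ _; set gb := bil _ _ _; set ge := bil _ _ _ => ga0 gb0 ge0.
split; first exact: key.
  by rewrite (_ : _ * _ * _ = gb * ga * (gb * ge) * (ga * ge)) ?key //; ring.
by rewrite (_ : _ * _ * _ = ge * ga * (ge * gb) * (ga * gb)) ?key //; ring.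
Qed.

(** The vectors of b, w1 and w2 lie in the plane orthogonal to that of a, where
    their three products can have any signs. *)
Lemma q_compl_triangle_twins a b e w1 w2 :
    uniq [:: a; b; e; w1; w2] -> grows G [set i in [:: a; b; e; w1; w2]] ->
    [/\ G a b, G a e & G b e] -> [/\ G a w1, G a w2 & ~~ G w1 w2] ->
    [/\ ~~ G b w1, ~~ G e w1, ~~ G b w2 & ~~ G e w2] ->
  (q_graph R (compl_graph G) <= 3)%N.
Proof.
move=> uvs gvs [Gab Gae Gbe] [Ga1 Ga2 /negPf G12] [/negPf Gb1 /negPf Ge1 /negPf Gb2 /negPf Ge2].
apply: (@q_compl_le_int_obtuse R n G 3 [:: a; b; e; w1; w2]
  [:: [:: 1; 0; 0]; [:: 0; 1; 0]; [:: 0; 0; 1]; [:: 0; 1; 2]; [:: 0; 1; -1]] a 1 3 4) => //.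
move=> p q /= /andP[pq q5].
by case: q q5 pq => [|[|[|[|[|//]]]]] _ //; case: p => [|[|[|[|//]]]] //= _;
  rewrite ?Gab ?Gae ?Gbe ?Ga1 ?Ga2 ?G12 ?Gb1 ?Ge1 ?Gb2 ?Ge2.
Qed.

(** The three leaves are pairwise nonadjacent and form the triple. *)
Lemma q_compl_triangle_net a b e wa wb we :
    uniq [:: a; b; e; wa; wb; we] -> grows G [set i in [:: a; b; e; wa; wb; we]] ->
    [/\ G a b, G a e & G b e] -> [/\ G a wa, G b wb & G e we] ->
    [/\ ~~ G a wb, ~~ G a we, ~~ G b wa & ~~ G b we] -> [/\ ~~ G e wa & ~~ G e wb] ->
    [/\ ~~ G wa wb, ~~ G wa we & ~~ G wb we] ->
  (q_graph R (compl_graph G) <= 3)%N.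
Proof.
move=> uvs gvs [Gab Gae Gbe] [Gaa Gbb Gee] [/negPf G1 /negPf G2 /negPf G3 /negPf G4]
  [/negPf G5 /negPf G6] [/negPf G7 /negPf G8 /negPf G9].
apply: (@q_compl_le_int_obtuse R n G 3 [:: a; b; e; wa; wb; we]
  [:: [:: 1; 0; 0]; [:: 0; 1; 0]; [:: 0; 0; 1]; [:: 0; 1; 1]; [:: 1; 0; 1]; [:: 1; -1;
      0]] a 3 4 5) => //.
move=> p q /= /andP[pq q5].
by case: q q5 pq => [|[|[|[|[|[|//]]]]]] _ //; case: p => [|[|[|[|[|//]]]]] //= _;
  rewrite ?Gab ?Gae ?Gbe ?Gaa ?Gbb ?Gee ?G1 ?G2 ?G3 ?G4 ?G5 ?G6 ?G7 ?G8 ?G9.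
Qed.

(** The complement is a path w b, w e and the isolated vertex a: its adjacency
    matrix has rank 2. *)
Lemma q_compl_paw a b e w :
    uniq [:: a; b; e; w] -> (forall i, i \in [:: a; b; e; w]) ->
    [/\ G a b, G a e & G b e] -> [/\ G a w, ~~ G b w & ~~ G e w] ->
  (q_graph R (compl_graph G) <= 3)%N.
Proof.
move=> uvs allv [Gab Gae Gbe] [Gaw Gbw Gew].
pose u : 'rV[R]_n := \row_i (i == w)%:R.
pose v : 'rV[R]_n := \row_i ((i == b) || (i == e))%:R.
pose A := u^T *m v + v^T *m u.
have AS : S_graph (compl_graph G) A.
  split; first by rewrite linearD /= !trmx_mul !trmxK addrC.
  have AE i j : A i j = (i == w)%:R * ((j == b) || (j == e))%:R + ((i == b) || (i == e))%:R * (j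
      == w)%:R.
    by rewrite !mxE !big_ord1 !mxE.
  move: uvs; rewrite /= !inE !negb_or !andbT => /and3P[/and3P[/negPf ab /negPf ae /negPf aw]
      /andP[/negPf be /negPf bw] /negPf ew].
  have [ba [ea wa]] : (b == a) = false /\ (e == a) = false /\ (w == a) =
      false by rewrite ![_ == a]eq_sym.
  have [eb [wb we]] : (e == b) = false /\ (w == b) = false /\ (w == e) = false.
    by rewrite [e == b]eq_sym ![w == _]eq_sym.
  move=> i j; rewrite AE /= /compl_rel.
  have := allv i; have := allv j; rewrite !inE.
  move=> /or4P[/eqP ->|/eqP ->|/eqP ->|/eqP ->] /or4P[/eqP ->|/eqP ->|/eqP ->|/eqP ->];
    rewrite ?eqxx // ?ab ?ae ?aw ?be ?bw ?ew ?ba ?ea ?wa ?eb ?wb ?we //= => _;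
    rewrite ?[G b a]adj_sym ?[G e _]adj_sym ?[G w _]adj_sym ?Gab ?Gae ?Gbe ?Gaw ?(negPf Gbw)
        ?(negPf Gew);
    rewrite ?mulr0 ?mul0r ?mulr1 ?add0r ?addr0 ?oner_eq0 ?eqxx //.
apply: leq_trans (q_graph_le AS) _; apply: leq_trans (q_mx_le_rank A) _.
have rk1 (p q : 'rV[R]_n) : (\rank (p^T *m q) <= 1)%N.
  exact: leq_trans (mxrankM_maxl _ _) (rank_leq_col _).
rewrite -[3%N]/(1 + 1 + 1)%N leq_add2r.
exact: leq_trans (mxrank_add _ _) (leq_add (rk1 _ _) (rk1 _ _)).
Qed.

Lemma iso_T22 a b e wa wb :
    uniq [:: wa; a; e; b; wb] -> (forall i, i \in [:: wa; a; e; b; wb]) ->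
    [/\ G a b, G a e & G b e] -> [/\ G a wa & G b wb] ->
    [/\ ~~ G a wb, ~~ G b wa, ~~ G e wa, ~~ G e wb & ~~ G wa wb] ->
  graph_iso G T22.
Proof.
move=> uvs allv [Gab Gae Gbe] [Gaa Gbb] [/negPf G1 /negPf G2 /negPf G3 /negPf G4 /negPf G5].
set vs := [:: wa; a; e; b; wb] in uvs allv.
have idx i : (index i vs < 5)%N by rewrite -[5%N]/(size vs) index_mem.
pose f i := Ordinal (idx i).
have nf i : nth a vs (f i) = i by rewrite nth_index.
exists f.
  apply: inj_card_bij.
    by move=> i j fij; rewrite -(nf i) fij nf.
  rewrite !card_ord -[5%N]/(size vs) -(card_uniqP uvs) -[n in (_ <= n)%N]card_ord.
  exact: max_card.
move=> i j; rewrite -{2}(nf i) -{2}(nf j).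
case: (f i) => p p5; case: (f j) => q q5 /=; rewrite /T22_rel /path_rel /=.
case: p p5 => [|[|[|[|[|//]]]]] _; case: q q5 => [|[|[|[|[|//]]]]] _ //=;
  rewrite ?adj_irr ?Gab ?Gae ?Gbe ?Gaa ?Gbb ?G1 ?G2 ?G3 ?G4 ?G5 //;
  rewrite adj_sym ?Gab ?Gae ?Gbe ?Gaa ?Gbb ?G1 ?G2 ?G3 ?G4 ?G5 //.
Qed.

End Triangle.

(** * The theorem *)

Section TriangleCases.
Variables (R : realType) (n : nat) (G : sgraph n).

(** If every vertex outside the triangle is adjacent to it, all of them are
    leaves, since an edge between two of them would close another cycle; then the
    cases are distinguished by where the leaves hang. *)
Lemma q_compl_cycle3 c : sole_cycle G c -> size c = 3%N -> ~ graph_iso G T22 ->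
  (q_graph R (compl_graph G) <= 3)%N.
Proof.
move=> c_sole c3 noniso.
have gc := sole_cycle_grows c_sole.
have fewc w := @few_nbrs_cycle n G c w c_sole.
have adjE := cycle_chordless c_sole.
have [[w0 wc far]|nofar] := pselect (exists2 w, w \notin c & forall u, u \in c -> ~~ G w u).
  move: c_sole c3 gc adjE wc far; case: c {fewc} => [|a [|b [|e [|//]]]] // c_sole _ gc adjE wc
      far.
  apply: (q_compl_triangle_far R _ gc _ wc); first by case: c_sole => _ /andP[].
    split; [exact: (adjE a 0%N 1%N)|exact: (adjE a 0%N 2%N)|exact: (adjE a 1%N 2%N)].
  by split; apply: far; rewrite !inE eqxx ?orbT.
have hung w : w \notin c -> exists2 u, u \in c & G w u.
  move=> wc; apply: contrapT => now; apply: nofar; exists w => // u uc.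
  by apply/negP => wu; apply: now; exists u.
have indep w1 w2 : w1 \notin c -> w2 \notin c -> ~~ G w1 w2.
  move=> w1c w2c; apply/negP => w12.
  have [|Sc|w [wS wc few]] := @cycle_leaf_outside n G c c_sole [set i | (i \in c) || (i \in [::
      w1; w2])].
  - by move=> i ic; rewrite inE ic.
  - by case/negP: w1c; apply: Sc; rewrite !inE eqxx orbT.
  move: wS; rewrite !inE (negPf wc) /= => /orP[/eqP ww|/eqP ww].
    have [u uc w1u] := hung w1 w1c.
    by move: w2c; rewrite -(few u w2) ?uc // ?inE ?uc ?eqxx ?orbT // ww.
  have [u uc w2u] := hung w2 w2c.
  by move: w1c; rewrite -(few u w1) ?uc // ?inE ?uc ?eqxx ?orbT // ww // adj_sym.
have growsS (S0 : {set 'I_n}) : {subset c <= S0} -> grows G S0.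
  move=> cS0; apply: grows_of_leaves => S /properP[S0S [w wS wS0]].
  have wc : w \notin c by apply: contra wS0 => /cS0.
  have inc u : G w u -> u \in c.
    by move=> wu; apply: contraLR wu => uc; apply: indep.
  exists w; split=> // u v _ _ wu wv.
  by apply: (fewc w wc) => //; rewrite inE inc.
have uniqnb w u v : w \notin c -> u \in c -> v \in c -> u != v -> G w u -> ~~ G v w.
  move=> wc uc vc uv wu; rewrite adj_sym; apply: contra uv => wv; apply/eqP.
  by apply: (fewc w wc); rewrite ?inE.
have [alone|[w1 w1c]] : (forall i, i \in c) \/ exists w, w \notin c.
  have [|] := pselect (exists w, w \notin c); [by right|move=> now; left=> i].
  by apply: contrapT => /negP ic; apply: now; exists i.
  have n3 : n = 3%N.
    rewrite -[LHS]card_ord -c3 -(card_uniqP (_ : uniq c)); last by case: c_sole => _ /andP[].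
    by apply: eq_card => i; rewrite !inE alone.
  by apply: leq_trans (q_graph_le_order R _) _; rewrite n3.
have [sc /andP[cyc uc] _] := c_sole.
have adjc u v : u \in c -> v \in c -> u != v -> G u v.
  move=> uc' vc uv; rewrite -(nth_index u uc') -(nth_index u vc) adjE ?index_mem //.
  have : index u c != index v c.
    by apply: contra_neq uv => /(congr1 (nth u c)); rewrite !nth_index.
  move: uc' vc; rewrite -!index_mem c3 /cyc_adj; lia.
have tri u v : u \in c -> v \in c -> u != v -> exists z,
    [/\ uniq [:: u; v; z], c =i [:: u; v; z] & [/\ G u v, G u z & G v z]].
  move=> uc' vc uv; have [i c1 rc] := rot_to uc'.
  have c1s : size c1 = 2 by have := size_rot i c; rewrite rc c3 => -[].
  have cE : c =i u :: c1 by move=> z; rewrite -rc mem_rot.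
  have ucs : uniq (u :: c1) by rewrite -rc rot_uniq.
  have [z [uvz zE]] : exists z, uniq [:: u; v; z] /\ c =i [:: u; v; z].
    case: c1 c1s cE ucs {rc} => [|p [|q []]] // _ cE upq.
    have : v \in [:: u; p; q] by rewrite -cE.
    rewrite !inE eq_sym (negPf uv) /= => /orP[/eqP ->|/eqP ->]; first by exists q.
    exists p; have E : [:: u; p; q] =i [:: u; q; p] by move=> z;
        rewrite !inE orbCA orbC -orbA orbC; case: (z == u); case: (z == p); case: (z == q).
    split; last by move=> z; rewrite cE E.
    by have upq' : uniq [:: u; p; q] := upq; rewrite (eq_uniq _ E) in upq'.
  exists z; split=> //; move: uvz; rewrite /= !inE !negb_or andbT => /andP[/andP[_ uz] vz].
  by split; apply: adjc; rewrite ?zE ?inE ?eqxx ?orbT.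
have twins u w w' : u \in c -> w \notin c -> w' \notin c -> w != w' -> G w u -> G w' u ->
    (q_graph R (compl_graph G) <= 3)%N.
  move=> uc' wc w'c ww' wu w'u.
  have [v [vc uv]] : exists v, v \in c /\ u != v.
    exists (next c u); rewrite mem_next; split=> //.
    by apply: contraTneq (next_cycle cyc uc') => <-; rewrite adj_irr.
  have [z [uvz cE Guvz]] := tri u v uc' vc uv.
  have zc : z \in c by rewrite cE !inE eqxx !orbT.
  have uz : u != z by move: uvz; rewrite /= !inE !negb_or => /andP[/andP[]].
  apply: (@q_compl_triangle_twins R n G u v z w w') => //.
  - rewrite -[[:: u; v; z; w; w']]/([:: u; v; z] ++ [:: w; w']) cat_uniq uvz /= -!cE.
    by rewrite (negPf wc) (negPf w'c) /= inE ww'.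
  - by apply: growsS => i; rewrite cE !inE => /or3P[] ->; rewrite ?orbT.
  - by split; rewrite 1?adj_sym // indep.
  - by split; apply: (uniqnb _ u).
have [a ac w1a] := hung w1 w1c.
have [[w2 w2c w12]|alone] := pselect (exists2 w2, w2 \notin c & w1 != w2); last first.
  have na : a != next c a by apply: contraTneq (next_cycle cyc ac) => <-; rewrite adj_irr.
  have bc : next c a \in c by rewrite mem_next.
  have [e [abe cE Gabe]] := tri a (next c a) ac bc na.
  have ec : e \in c by rewrite cE !inE eqxx !orbT.
  have ae : a != e by move: abe; rewrite /= !inE !negb_or => /andP[/andP[]].
  apply: (@q_compl_paw R n G a (next c a) e w1) => //.
  - by rewrite -[[:: a; next c a; e; w1]]/([:: a; next c a;
      e] ++ [:: w1]) cat_uniq abe /= -!cE (negPf w1c).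
  - move=> i; rewrite -[[:: a; next c a; e; w1]]/([:: a; next c a; e] ++ [:: w1]) mem_cat -cE inE.
    have [//|ic /=] := boolP (i \in c); rewrite eq_sym.
    by apply: contrapT => /negP wi; apply: alone; exists i.
  - by rewrite adj_sym; split=> //; apply: (uniqnb _ a).
have [b bc w2b] := hung w2 w2c.
have [ab|ab] := eqVneq a b; first by apply: (twins a w1 w2) => //; rewrite ab.
have [e [abe cE Gabe]] := tri a b ac bc ab.
have ec : e \in c by rewrite cE !inE eqxx !orbT.
have [ae be] : a != e /\ b != e.
  by move: abe; rewrite /= !inE !negb_or !andbT => /andP[/andP[]].
have [[w3 w3c [w13 w23]]|alone] := pselect (exists2 w3, w3 \notin c & w1 != w3 /\ w2 != w3);
    last first.
  case: noniso; have u5 : uniq [:: a; b; e; w1; w2].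
    rewrite -[[:: a; b; e; w1; w2]]/([:: a; b; e] ++ [:: w1; w2]) cat_uniq abe /= -!cE.
    by rewrite (negPf w1c) (negPf w2c) /= inE w12.
  have E : [:: w1; a; e; b; w2] =i [:: a; b; e; w1; w2].
    by move=> i; rewrite !inE; case: (i == a); case: (i == b); case: (i == e); case: (i == w1).
  apply: (@iso_T22 n G a b e w1 w2) => //.
  - by rewrite (eq_uniq _ E).
  - move=> i; rewrite E -[[:: a; b; e; w1; w2]]/([:: a; b; e] ++ [:: w1; w2]) mem_cat -cE !inE.
    have [//|ic /=] := boolP (i \in c); rewrite ![i == _]eq_sym.
    apply: contrapT => /negP; rewrite negb_or => /andP[w1i w2i].
    by apply: alone; exists i.
  - by split; rewrite adj_sym.
  - by split; [apply: (uniqnb w2 b)|apply: (uniqnb w1 a)|apply: (uniqnb w1 a)|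
               apply: (uniqnb w2 b)|apply: indep] => //; rewrite eq_sym.
have [u uc' w3u] := hung w3 w3c.
move: (uc'); rewrite cE !inE => /or3P[/eqP uE|/eqP uE|/eqP uE].
- by apply: (twins a w1 w3) => //; rewrite -uE.
- by apply: (twins b w2 w3) => //; rewrite -uE.
apply: (@q_compl_triangle_net R n G a b e w1 w2 w3) => //.
- rewrite -[[:: a; b; e; w1; w2; w3]]/([:: a; b; e] ++ [:: w1; w2; w3]) cat_uniq abe /= -!cE.
  by rewrite (negPf w1c) (negPf w2c) (negPf w3c) /= !inE negb_or w12 w13 w23.
- by apply: growsS => i; rewrite cE !inE => /or3P[] ->; rewrite ?orbT.
- by rewrite -uE; split; rewrite adj_sym.
- rewrite -uE in ae be.
  by split; [apply: (uniqnb w2 b)|apply: (uniqnb w3 u)|apply: (uniqnb w1 a)|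
             apply: (uniqnb w3 u)] => //; rewrite eq_sym.
- by split; [apply: (uniqnb w1 a)|apply: (uniqnb w2 b)].
- by split; apply: indep.
Qed.

End TriangleCases.

Section Exclusions.

(** The largest vertex of a cycle would have two neighbours below it. *)
Lemma path_graph_acyclic m (c : seq 'I_m) : ucycle (path_graph m) c -> ~ (2 < size c)%N.
Proof.
move=> /andP[cyc uc] sc.
have [x xc xmax] : exists2 x, x \in c & forall y, y \in c -> (y <= x)%N.
  have [x0 x0c] : exists x0, x0 \in c by case: (c) sc => // x s _; exists x; rewrite mem_head.
  by case: (@arg_maxnP _ x0 (mem c) val x0c) => x xc xmax; exists x.
have [i c1 rc] := rot_to xc.
have c1c y : y \in c1 -> y \in c by move=> yc1; rewrite -(mem_rot i) rc inE yc1 orbT.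
have sc1 : (1 < size c1)%N by move: sc; rewrite -(size_rot i) rc.
have : uniq (x :: c1) by rewrite -rc rot_uniq.
have : cycle (path_graph m) (x :: c1) by rewrite -rc rot_cycle.
case: c1 sc1 c1c {rc} => [|y s] //= s0 c1c; rewrite rcons_path => /and3P[xy _ zx].
move=> /and3P[_ ys _].
have zs : last y s \in s by case: (s) s0 => //= p q _; rewrite mem_last.
have := xmax _ (c1c y (mem_head _ _)); have := xmax _ (c1c (last y s) (mem_last _ _)).
move: xy zx; rewrite /= /path_rel => xy zx yx zx'.
suff yz : y = last y s by rewrite yz zs in ys.
apply: val_inj => /=; lia.
Qed.

Lemma iso_ucycle m n (G : sgraph m) (H : sgraph n) (f : 'I_m -> 'I_n) c :
    bijective f -> (forall i j, H (f i) (f j) = G i j) ->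
  ucycle G c -> ucycle H (map f c).
Proof.
move=> /bij_inj fI fG /andP[cyc uc]; rewrite /ucycle map_inj_uniq // uc andbT.
case: c cyc {uc} => //= x s; rewrite -map_rcons path_map.
by congr is_true; apply: eq_path => i j; rewrite /= fG.
Qed.

Lemma sole_cycle_not_path m n (G : sgraph n) c : sole_cycle G c -> ~ graph_iso G (path_graph m).
Proof.
move=> [sc Gc _] [f fb fG]; apply: (@path_graph_acyclic m (map f c)).
  exact: iso_ucycle fb fG Gc.
by rewrite size_map.
Qed.

Lemma sole_cycle_not_house n (G : sgraph n) c :
  sole_cycle G c -> ~ graph_iso G (compl_graph (path_graph 5)).
Proof.
move=> [sc Gc cP] [f [g fg gf] fG].
have gb : bijective g by exists f.
have gG i j : G (g i) (g j) = compl_graph (path_graph 5) i j by rewrite -fG !gf.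
pose v i : 'I_5 := inord i.
have cyc s : ucycle (compl_graph (path_graph 5)) s -> (2 < size s)%N -> map g s =i c.
  by move=> Hs s2; apply: cP; rewrite ?size_map //; apply: iso_ucycle gb gG Hs.
have vE i j : (i < 5)%N -> (j < 5)%N -> (v i == v j) = (i == j).
  by move=> i5 j5; rewrite -val_eqE /= !inordK.
have Hv i j : (i < 5)%N -> (j < 5)%N -> compl_graph (path_graph 5) (v i) (v j) =
    (i != j) && ~~ ((i.+1 == j) || (j.+1 == i)).
  by move=> i5 j5; rewrite /= /compl_rel vE //= /path_rel !inordK.
(* A triangle and a 4-cycle of the complement of the path on 0, ..., 4. *)
have c1 : map g [:: v 0%N; v 2%N; v 4%N] =i c.
  by apply: cyc => //; apply/andP; split; [apply/and4P; split; rewrite ?Hv|rewrite /= !inE !vE].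
have c2 : map g [:: v 0%N; v 3%N; v 1%N; v 4%N] =i c.
  by apply: cyc => //; apply/andP; split; [apply/and5P; split; rewrite ?Hv|rewrite /= !inE !vE].
have : g (v 3%N) \in map g [:: v 0%N; v 2%N; v 4%N] by rewrite c1 -c2 map_f // !inE eqxx orbT.
rewrite mem_map; last exact: bij_inj.
by rewrite !inE !vE.
Qed.

End Exclusions.

Theorem theorem5p7 (R : realType) (n : nat) (G : sgraph n)
    (G_unicyclic : unicyclic G) (G_neq_T22 : ~ graph_iso G T22) :
  (q_graph R (compl_graph G) <= 4)%N /\
  ((q_graph R G + q_graph R (compl_graph G) <= n + 2)%N <->
   ~ (graph_iso G (path_graph 4) \/ graph_iso G (path_graph 5) \/
      graph_iso G (compl_graph (path_graph 5)) \/ graph_iso G T22)).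
Proof.
have [c c_sole] := unicyclic_sole_cycle G_unicyclic.
have nonex : ~ (graph_iso G (path_graph 4) \/ graph_iso G (path_graph 5) \/
      graph_iso G (compl_graph (path_graph 5)) \/ graph_iso G T22).
  move=> [|[|[|//]]]; [exact: sole_cycle_not_path c_sole..|exact: sole_cycle_not_house c_sole].
have qG := q_sole_cycle_le R c_sole.
have [c3|cN3] := eqVneq (size c) 3.
  have qGc := q_compl_cycle3 R c_sole c3 G_neq_T22.
  rewrite c3 eqxx in qG; split; first exact: leq_trans qGc _.
  split=> // _; lia.
have qGc : (q_graph R (compl_graph G) <= 4)%N.
  have [c4|cN4] := eqVneq (size c) 4; first exact: q_compl_cycle4 c_sole c4.
  apply: (q_compl_long_cycle R c_sole); case: c_sole => sc _ _; lia.
rewrite (negPf cN3) in qG; split=> //; split=> // _; lia.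
Qed.
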